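(* Let $X$ and $Y$ be dust-like self-similar sets, generated by the iterated function systems $\Phi$ and $\Psi$ respectively, and assume that at least one of the sets of ratios $R(\Phi)$, $R(\Psi)$ is commensurable. If $\dim_{\mathrm H} X=\dim_{\mathrm H} Y$ and there exists a Lipschitz surjection $X\to Y$, then there also exists a Lipschitz surjection $Y\to X$.
   Context: A self-similar set is a compact set $X\subset\mathbb R^d$ satisfying $X=\bigcup_{i=1}^n S_i(X)$, where each $S_i:\mathbb R^d\to\mathbb R^d$ is a contracting similarity (i.e. $|S_i(x)-S_i(y)|=r_i|x-y|$ with $r_i\in(0,1)$, the ratio of $S_i$). The set $\Phi=\{S_1,\dots,S_n\}$ is the iterated function system (IFS) generating $X$. $X$ is dust-like (with respect to its generating IFS) if the sets $S_i(X)$ are pairwise disjoint. $R(\Phi)$ denotes the set of ratios of the similarities in $\Phi$. A set $R\subseteq\mathbb R^+$ is commensurable if $\log r_1/\log r_2\in\mathbb Q$ for every $r_1,r_2\in R$. $\dim_{\mathrm H}$ is the Hausdorff dimension. *)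

(* Defs.v *)
From HB Require Import structures.
From mathcomp Require Import all_boot all_order all_algebra.
From mathcomp Require Import all_classical all_reals all_analysis.

Set Implicit Arguments.
Unset Strict Implicit.
Unset Printing Implicit Defensive.

Import Order.TTheory GRing.Theory Num.Theory numFieldNormedType.Exports.

Local Open Scope classical_set_scope.
Local Open Scope ring_scope.

(* The norm carried by 'rV[R]_d in the library is the sup norm, which has other
   similarities than the Euclidean one.  All metric notions below use [edist];
   the topology of 'rV[R]_d (for [compact]) is the same for both norms. *)
Definition edist (R : realType) (d : nat) (x y : 'rV[R]_d) : R :=
  Num.sqrt (\sum_(i < d) (x ord0 i - y ord0 i) ^+ 2).

Definition similarity (R : realType) (d : nat) (r : R)
    (S : 'rV[R]_d -> 'rV[R]_d) : Prop :=
  forall x y, edist (S x) (S y) = r * edist x y.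

Record ifs (R : realType) (d n : nat) := Ifs {
  ifs_map :> 'I_n -> 'rV[R]_d -> 'rV[R]_d ;
  ifs_ratio : 'I_n -> R ;
  ifs_ratio_itv : forall i, 0 < ifs_ratio i < 1 ;
  ifs_similarity : forall i, similarity (ifs_ratio i) (ifs_map i) }.

Definition ratios (R : realType) (d n : nat) (Phi : ifs R d n) : set R :=
  range (ifs_ratio Phi).

Definition self_similar (R : realType) (d n : nat) (Phi : ifs R d n)
    (X : set 'rV[R]_d) : Prop :=
  compact X /\ X = \bigcup_i (Phi i @` X).

Definition dust_like (R : realType) (d n : nat) (Phi : ifs R d n)
    (X : set 'rV[R]_d) : Prop :=
  forall i j, i != j -> (Phi i @` X) `&` (Phi j @` X) = set0.

Definition commensurable (R : realType) (A : set R) : Prop :=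
  forall r1 r2, A r1 -> A r2 -> exists q : rat, ln r1 / ln r2 = ratr q.

(* A map X -> Y is represented by a total map whose values off X are
   irrelevant. *)
Definition lipschitz_surjection (R : realType) (d e : nat)
    (X : set 'rV[R]_d) (Y : set 'rV[R]_e) (f : 'rV[R]_d -> 'rV[R]_e) : Prop :=
  f @` X = Y /\
  exists L : R, forall x y, X x -> X y -> edist (f x) (f y) <= L * edist x y.

Local Open Scope ereal_scope.

(* [diam set0] is -oo. *)
Definition diam (R : realType) (d : nat) (U : set 'rV[R]_d) : \bar R :=
  ereal_sup [set (edist x y)%:E | x in U & y in U].

(* diam(U)^s, with the conventions 0^0 = 1 and diam(set0)^s = 0; the latter
   lets sequences of sets represent finite covers even when s = 0. *)
Definition diam_pow (R : realType) (d : nat) (s : R) (U : set 'rV[R]_d)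
    : \bar R :=
  if U == set0 then 0 else diam U `^ s.

Definition hausdorff_content (R : realType) (d : nat) (s delta : R)
    (A : set 'rV[R]_d) : \bar R :=
  ereal_inf [set \sum_(k <oo) diam_pow s (U k) | U in
    [set U : (set 'rV[R]_d)^nat |
      A `<=` \bigcup_k U k /\ forall k, diam (U k) <= delta%:E]].

Definition hausdorff_measure (R : realType) (d : nat) (s : R)
    (A : set 'rV[R]_d) : \bar R :=
  ereal_sup [set hausdorff_content s delta A | delta in
    [set delta : R | (0 < delta)%R]].

Definition hausdorff_dim (R : realType) (d : nat) (A : set 'rV[R]_d)
    : \bar R :=
  ereal_inf [set s%:E | s in
    [set s : R | (0 <= s)%R /\ hausdorff_measure s A = 0]].

(* Main.v *)
Require Import Defs.
From mathcomp Require Import all_boot all_order all_algebra.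
From mathcomp Require Import all_classical all_reals all_analysis.
From mathcomp Require Import ring lra zify.

Set Implicit Arguments.
Unset Strict Implicit.
Unset Printing Implicit Defensive.
Import Order.TTheory GRing.Theory Num.Theory numFieldNormedType.Exports.
Local Open Scope classical_set_scope.
Local Open Scope ring_scope.

(* The bare name would denote the extended distance of a pseudometric space. *)
Local Notation edist := Defs.edist.

(** Coding points by their addresses turns a dust-like self-similar set with
    ratios [r] into the space of sequences of letters, with the distance between
    two sequences given by the product of the ratios of their common prefix
    ([coding_exists]).  If [s] is the exponent with sum of [r i `^ s] equal to 1,
    then [s] is the Hausdorff dimension ([coded_dimension]); so, both sets having
    the same dimension, raising all distances to the power [s] replaces the
    ratios on both sides by weights [w] and [v] of sum 1, and keeps Lipschitz
    maps Lipschitz.  If one of the sets is empty or a point then so is the other,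
    and the claim is immediate.  Otherwise it results from two statements about
    sequences.

    A Lipschitz surjection from sequences weighted by [w] to sequences weighted
    by [v] forces all the weights to be powers of a single number, as soon as the
    weights on one side are ([common_base]).  To see this, consider finite
    families of maps into the target whose images cover it, a map with Lipschitz
    constant [L] counting for the mass [L].  Such a family can be restricted to a
    cylinder of the target and rescaled, which yields another covering family.
    A family of minimal mass exists by compactness; all its restrictions are
    again minimal, and none of its members is superfluous.  By compactness again
    this irredundancy is visible at a bounded depth, where a single member covers
    a whole cylinder by finitely many pieces of comparable sizes; the mass of
    these pieces being prescribed, only finitely many Lipschitz constants occur
    in minimal families ([optimal_ratios_finite]).  Following a sequence and its
    image through successive restrictions, the quotients of the weights of their
    prefixes then repeat themselves ([surjection_weight_relation]).  For the
    constant sequence with letter [i] on one side this reads [z ^+ a = p ^+ b],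
    where [z] is the weight of [i] and [p] a common base for the other side.

    Conversely, if all the weights are powers of [q], there are Lipschitz
    surjections in both directions ([common_base_surjection]).  Write P and Q for
    the sums of the monomials whose exponents are those of [w] and of [v], so
    that P(q) = Q(q) = 1.  It suffices to find nonzero polynomials a, b with
    natural coefficients and (1 - P) a = (1 - Q) b: a multiset of cylinders of
    the source with sizes prescribed by a can then be subdivided, according to b,
    into one scaled copy of itself for each letter of the target, and iterating
    this subdivision defines the map.  The quotients of 1 - Q and 1 - P by
    1 - z / q are real solutions with positive coefficients up to their degrees,
    and the equation being linear with integer coefficients, they can be replaced
    by integer ones ([integer_balance]). *)

(** * Limits along an ultrafilter *)

(** Limits are taken along an ultrafilter finer than the neighbourhoods of infinity:
    sequences in a finite set or in a compact space then converge, and no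
    subsequences have to be extracted. *)
Lemma ultra_oo : exists F : set_system nat,
  UltraFilter F /\ forall k, F [set t | (k <= t)%N].
Proof.
have [F [FU sub]] := ultraFilterLemma (F := \oo) _.
by exists F; split=> // k; apply: sub; exists k.
Qed.

Lemma ultra_limit_fin (F : set_system nat) (T : finType) (s : nat -> T) :
  UltraFilter F -> exists t, F [set k | s k = t].
Proof.
move=> FU; apply: contrapT => H.
have /filter_ex [k Hk] : \forall k \near F, forall t, s k <> t.
  apply: filter_forall => t.
  have [Ft|//] := in_ultra_setVsetC [set k | s k = t] FU.
  by case: H; exists t.
exact: (Hk (s k)).
Qed.

Lemma ultra_limit_compact (T : topologicalType) (X : set T) (p : nat -> T)
    (F : set_system nat) : UltraFilter F -> compact X -> (forall k, X (p k)) ->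
  exists2 q, X q & forall B, nbhs q B -> F [set k | B (p k)].
Proof.
move=> FU cX Xp.
have [q [Xq clq]] := cX (p @ F) _ (filterS (fun k _ => Xp k) filterT).
exists q => // B nB.
have [//|FC] := in_ultra_setVsetC [set k | B (p k)] FU.
have [x [nBx Bx]] := clq (~` B) B FC nB.
by case: nBx.
Qed.

(** * Sequences and words over a finite alphabet *)

Section Sequences.
Variable T : Type.
Implicit Types (x y : nat -> T) (I J : seq T) (a b : nat).

Definition scons (i : T) x : nat -> T := fun t => if t is t'.+1 then x t' else i.
Definition scat I x : nat -> T := foldr scons x I.
Definition sskip a x : nat -> T := fun t => x (a + t)%N.
Definition agree a x y := forall t, (t < a)%N -> x t = y t.

Lemma scons_drop x : scons (x 0%N) (sskip 1 x) = x.
Proof. by apply/funext => -[|t]. Qed.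

Lemma sskip1_scons i x : sskip 1 (scons i x) = x.
Proof. by []. Qed.

Lemma sskip0 x : sskip 0 x = x.
Proof. by []. Qed.

Lemma sskip_add a b x : sskip a (sskip b x) = sskip (b + a) x.
Proof. by apply/funext => t; rewrite /sskip addnA. Qed.

Lemma mkseq_cons x a : mkseq x a.+1 = x 0%N :: mkseq (sskip 1 x) a.
Proof. by rewrite /mkseq /= (iotaDl 1 0) -map_comp. Qed.

Lemma scat_take a x : scat (mkseq x a) (sskip a x) = x.
Proof.
elim: a x => [//|a IHa] x; rewrite mkseq_cons /=.
by have := IHa (sskip 1 x); rewrite sskip_add add1n => ->; rewrite scons_drop.
Qed.

Lemma sskip_scat I x : sskip (size I) (scat I x) = x.
Proof.
elim: I => [//|i I IHI] /=.
by rewrite -[(size I).+1]add1n -sskip_add sskip1_scons.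
Qed.

Lemma mkseq_scat I x a : mkseq (scat I x) (size I + a) = I ++ mkseq x a.
Proof. by elim: I => [//|i I IHI] /=; rewrite addSn mkseq_cons sskip1_scons IHI. Qed.

Lemma mkseq_addn x a b : mkseq x (a + b) = mkseq x a ++ mkseq (sskip a x) b.
Proof.
by have := mkseq_scat (mkseq x a) (sskip a x) b; rewrite scat_take size_mkseq.
Qed.

Lemma agree_sym a x y : agree a x y -> agree a y x.
Proof. by move=> H t /H. Qed.

Lemma agree_trans a x y z : agree a x y -> agree a y z -> agree a x z.
Proof. by move=> H H' t ta; rewrite H ?H'. Qed.

Lemma agree_le a b x y : (a <= b)%N -> agree b x y -> agree a x y.
Proof. by move=> ab H t ta; apply: H; apply: leq_trans ab. Qed.

Lemma agree0 x y : agree 0 x y.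
Proof. by []. Qed.

Lemma agree_mkseq a x y : agree a x y -> mkseq x a = mkseq y a.
Proof.
by move=> H; apply/eq_in_map => t; rewrite mem_iota => /andP[_]; apply: H.
Qed.

Lemma agreeS a x y : agree a.+1 x y <->
  x 0%N = y 0%N /\ agree a (sskip 1 x) (sskip 1 y).
Proof.
split=> [H|[H0 H] [|t] // ta]; last exact: (H t).
by split=> [|t ta]; [apply: H | apply: (H t.+1)].
Qed.

Lemma agree_scons a i x y : agree a x y -> agree a.+1 (scons i x) (scons i y).
Proof. by move=> H; apply/agreeS. Qed.

Lemma agree_scat I a x y :
  agree a x y -> agree (size I + a) (scat I x) (scat I y).
Proof. by move=> H; elim: I => //= i I; apply: agree_scons. Qed.

Lemma agree_all x y : (forall a, agree a x y) -> x = y.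
Proof. by move=> H; apply/funext => t; apply: (H t.+1). Qed.

Lemma first_difference x y : x <> y ->
  exists a, agree a x y /\ ~ agree a.+1 x y.
Proof.
move=> xy; have ex : exists a, `[< ~ agree a x y >].
  apply: contrapT => H; apply: xy; apply: agree_all => a.
  by apply: contrapT => Ha; apply: H; exists a; apply/asboolP.
case: (ex_minnP ex) => [[|b]] /asboolP Hb mb; first by case: Hb.
exists b; split=> //; apply: contrapT => Hb'.
by have := mb b; rewrite ltnn; move/(_ (asboolT Hb')).
Qed.

End Sequences.

Lemma ultra_limit_seq (F : set_system nat) (T : finType) (x : nat -> nat -> T) :
  UltraFilter F -> exists xl, forall b, F [set k | agree b (x k) xl].
Proof.
move=> FU; have [xl Hxl] := choice (fun t => ultra_limit_fin (fun k => x k t) FU).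
have FF : Filter F by exact: _.
exists xl; elim=> [|b IHb]; first by apply: filterS filterT.
have : F ([set k | agree b (x k) xl] `&` [set k | x k b = xl b]) by apply: filterI.
apply: filterS => k [H Hb] t.
by rewrite ltnS leq_eqVlt => /orP[/eqP ->//|]; apply: H.
Qed.

(** * Weights and symbolic Lipschitz maps *)

Section Weights.
Variables (R : realType) (T : finType) (w : T -> R).

Definition probability_vector : Prop :=
  (forall i, 0 < w i < 1) /\ \sum_i w i = 1.

Definition wt (I : seq T) : R := \prod_(i <- I) w i.
Definition prefix_wt (x : nat -> T) (a : nat) : R := wt (mkseq x a).

Lemma wt_nil : wt [::] = 1.
Proof. by rewrite /wt big_nil. Qed.

Lemma wt_cons i I : wt (i :: I) = w i * wt I.
Proof. by rewrite /wt big_cons. Qed.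

Lemma wt_cat I J : wt (I ++ J) = wt I * wt J.
Proof. by rewrite /wt big_cat. Qed.

Lemma prefix_wt0 x : prefix_wt x 0 = 1.
Proof. exact: wt_nil. Qed.

Lemma prefix_wtS x a :
  prefix_wt x a.+1 = w (x 0%N) * prefix_wt (sskip 1 x) a.
Proof. by rewrite /prefix_wt mkseq_cons wt_cons. Qed.

Lemma prefix_wt_scat I x a :
  prefix_wt (scat I x) (size I + a) = wt I * prefix_wt x a.
Proof. by rewrite /prefix_wt mkseq_scat wt_cat. Qed.

Lemma agree_prefix_wt a x y : agree a x y -> prefix_wt x a = prefix_wt y a.
Proof. by move=> H; rewrite /prefix_wt (agree_mkseq H). Qed.

Lemma prefix_wtD x a b :
  prefix_wt x (a + b) = prefix_wt x a * prefix_wt (sskip a x) b.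
Proof. by rewrite /prefix_wt mkseq_addn wt_cat. Qed.

Lemma wt_const_prefix i a : prefix_wt (fun=> i) a = w i ^+ a.
Proof.
elim: a => [|a IHa]; first by rewrite prefix_wt0 expr0.
by rewrite prefix_wtS exprS IHa.
Qed.

Hypothesis w01 : forall i, 0 < w i < 1.

Lemma wt_gt0 I : 0 < wt I.
Proof.
elim: I => [|i I IHI]; first by rewrite wt_nil.
by rewrite wt_cons mulr_gt0 //; have /andP[] := w01 i.
Qed.

Lemma wt_le1 I : wt I <= 1.
Proof.
elim: I => [|i I IHI]; first by rewrite wt_nil.
have /andP[w0 w1] := w01 i; have := wt_gt0 I.
by rewrite wt_cons; nra.
Qed.

Lemma prefix_wt_gt0 x a : 0 < prefix_wt x a.
Proof. exact: wt_gt0. Qed.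

Lemma prefix_wt_le1 x a : prefix_wt x a <= 1.
Proof. exact: wt_le1. Qed.

Lemma prefix_wt_le x a b : (a <= b)%N -> prefix_wt x b <= prefix_wt x a.
Proof.
move=> /subnKC <-; rewrite prefix_wtD.
have := prefix_wt_gt0 x a; have := prefix_wt_le1 (sskip a x) (b - a).
have := prefix_wt_gt0 (sskip a x) (b - a); nra.
Qed.

Lemma prefix_wt_lt x a b : (a < b)%N -> prefix_wt x b < prefix_wt x a.
Proof.
move=> /subnKC <-; rewrite -addn1 -addnA prefix_wtD add1n prefix_wtS.
have /andP[w0 w1] := w01 (sskip a x 0%N).
rewrite gtr_pMr ?prefix_wt_gt0 //; apply: le_lt_trans w1.
by rewrite ger_pMr // prefix_wt_le1.
Qed.

Lemma lt_prefix_wt x a b : prefix_wt x b < prefix_wt x a -> (a < b)%N.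
Proof.
by move=> H; rewrite ltnNge; apply/negP => /(prefix_wt_le x); rewrite leNgt H.
Qed.

Lemma weight_bounds : exists lo hi, [/\ 0 < lo, lo < 1, 0 < hi, hi < 1 &
  forall i, lo <= w i <= hi].
Proof.
suff [lo [hi [lo0 lo1 hi0 hi1 H]]] : exists lo hi, [/\ 0 < lo, lo < 1, 0 < hi,
    hi < 1 & forall i, i \in enum T -> lo <= w i <= hi].
  by exists lo, hi; split=> // i; apply: H; rewrite mem_enum.
elim: (enum T) => [|i s [lo [hi [lo0 lo1 hi0 hi1 H]]]].
  by exists 2^-1, 2^-1; split=> //; lra.
have /andP[w0 w1] := w01 i.
exists (Num.min (w i) lo), (Num.max (w i) hi).
rewrite !lt_min !gt_max w0 w1 lo0 hi1 !(gt_min, lt_max) w1 w0; split=> // k.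
rewrite inE => /orP[/eqP ->|/H /andP[H1 H2]].
  by rewrite ge_min le_max lexx.
by rewrite ge_min le_max H1 H2 !orbT.
Qed.

Lemma wt_hi hi I : 0 < hi -> (forall i, w i <= hi) -> wt I <= hi ^+ size I.
Proof.
move=> hi0 H; elim: I => [|i I IHI]; first by rewrite wt_nil expr0.
rewrite wt_cons exprS ler_pM //; last exact: ltW (wt_gt0 _).
by have /andP[/ltW] := w01 i.
Qed.

End Weights.

Lemma expr_small (R : realType) (h e : R) : 0 < h < 1 -> 0 < e ->
  exists a : nat, h ^+ a < e.
Proof.
move=> /andP[h0 h1] e0.
have nh : `|h| < 1 by rewrite ger0_norm // ltW.
have /cvgr0Pnorm_lt /(_ _ e0) [a _ Ha] := cvg_expr nh.
exists a; have := Ha a (leqnn a).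
by rewrite /= ger0_norm // exprn_ge0 // ltW.
Qed.

Lemma prefix_wt_small (R : realType) (T : finType) (w : T -> R) e :
  (forall i, 0 < w i < 1) -> 0 < e -> exists a, forall x, prefix_wt w x a < e.
Proof.
move=> w01 e0; have [lo [hi [_ _ hi0 hi1 H]]] := weight_bounds w01.
have h01 : 0 < hi < 1 by rewrite hi0.
have [a Ha] := expr_small h01 e0; exists a => x.
apply: le_lt_trans Ha; rewrite -[X in hi ^+ X](size_mkseq x a).
by apply: wt_hi => // i; have /andP[] := H i.
Qed.

Section Lipschitz.
Variables (R : realType) (T U : finType) (w : T -> R) (v : U -> R).

(** Sequences are at the distance given by the weight of their longest common
    prefix, so this is the Lipschitz condition for that ultrametric; quantifying
    over all prefix lengths avoids naming the longest one. *)
Definition lip (L : R) (f : (nat -> T) -> (nat -> U)) : Prop :=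
  forall x x' a b, agree a x x' ->
    L * prefix_wt w x a < prefix_wt v (f x) b -> agree b.+1 (f x) (f x').

Lemma lip_weaken L L' f : (forall i, 0 < w i < 1) -> L <= L' ->
  lip L f -> lip L' f.
Proof.
move=> w01 LL' H x x' a b ag lt; apply: H ag _.
by apply: le_lt_trans lt; rewrite ler_pM2r // prefix_wt_gt0.
Qed.

End Lipschitz.

Section Cuts.
Variables (R : realType) (T : finType) (w : T -> R).

(** The words at which [L] times the weight first drops below the threshold form
    a finite complete prefix code; they are collected by recursion on a bound for
    their lengths. *)
Lemma cut_exists (lo L th : R) :
  (forall i, 0 < w i < 1) -> \sum_i w i = 1 -> (forall i, lo <= w i) ->
  0 < L -> 0 < th ->
  exists S : seq (seq T), [/\ \sum_(I <- S) wt w I = 1,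
    forall I, I \in S -> L * wt w I <= th /\ (I = [::] \/ th * lo <= L * wt w I)
    & forall x, exists2 I, I \in S & exists x', x = scat I x'].
Proof.
move=> w01 w1 wlo; have [lo0 [hi [_ _ hi0 hi1 Hhi]]] := weight_bounds w01.
move=> L0 th0.
have [A HA] : exists A : nat, L * hi ^+ A <= th.
  have h01 : 0 < hi < 1 by rewrite hi0.
  have [A HA] := expr_small h01 (divr_gt0 th0 L0).
  by exists A; move: HA; rewrite ltr_pdivlMr // mulrC => /ltW.
elim: A L L0 HA => [|A IHA] L L0.
  rewrite expr0 mulr1 => Lth; exists [:: [::]]; split.
  - by rewrite big_seq1 wt_nil.
  - by move=> I; rewrite inE => /eqP ->; rewrite wt_nil mulr1; split; [|left].
  - by move=> x; exists [::]; rewrite ?inE //; exists x.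
move=> HA; have [Lth|thL] := leP L th.
  exists [:: [::]]; split.
  - by rewrite big_seq1 wt_nil.
  - by move=> I; rewrite inE => /eqP ->; rewrite wt_nil mulr1; split; [|left].
  - by move=> x; exists [::]; rewrite ?inE //; exists x.
have Hi i : exists S : seq (seq T), [/\ \sum_(I <- S) wt w I = 1,
    forall I, I \in S -> L * w i * wt w I <= th /\
      (I = [::] \/ th * lo <= L * w i * wt w I)
    & forall x, exists2 I, I \in S & exists x', x = scat I x'].
  have /andP[wi0 _] := w01 i; have /andP[_ wihi] := Hhi i.
  apply: IHA; first by rewrite mulr_gt0.
  apply: le_trans HA; rewrite exprS mulrA ler_pM2r ?exprn_gt0 //.
  by rewrite ler_pM2l.
have [S HS] := choice Hi.
exists (flatten (map (fun i => map (cons i) (S i)) (enum T))); split.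
- rewrite big_flatten /= big_map big_enum /= -[RHS]w1; apply: eq_bigr => i _.
  rewrite big_map -[RHS]mulr1; have [<- _ _] := HS i.
  by rewrite mulr_sumr; apply: eq_bigr => I _; rewrite wt_cons.
- move=> I /flatten_mapP [i _ /mapP [I' I'S ->]].
  have [_ /(_ _ I'S) [H1 H2] _] := HS i.
  rewrite wt_cons mulrA; split=> //; right; case: H2 => [->|//].
  have /andP[wi0 _] := w01 i.
  by rewrite wt_nil mulr1; have := wlo i; nra.
- move=> x; have [_ _ /(_ (sskip 1 x)) [I IS [x' xE]]] := HS (x 0%N).
  exists (x 0%N :: I).
    by apply/flatten_mapP; exists (x 0%N); [rewrite mem_enum|exact: map_f].
  by exists x'; rewrite /= -xE scons_drop.
Qed.

(** Only short words have a large weight. *)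
Lemma heavy_words_finite (e : R) : (forall i, 0 < w i < 1) -> 0 < e ->
  exists Q : seq R, forall I, e <= wt w I -> wt w I \in Q.
Proof.
move=> w01 e0; have [lo0 [hi [_ _ hi0 hi1 Hhi]]] := weight_bounds w01.
have h01 : 0 < hi < 1 by rewrite hi0.
have [A HA] := expr_small h01 e0.
exists [seq wt w (bseqval b) | b : A.-bseq T] => I eI.
have sI : (size I <= A)%N.
  rewrite leqNgt; apply/negP => AI.
  have : wt w I <= hi ^+ A.
    apply: (le_trans (wt_hi w01 I hi0 _)).
      by move=> i; have /andP[] := Hhi i.
    by apply: ler_wiXn2l; rewrite ?(ltW hi0) ?(ltW hi1) ?(ltnW AI).
  by rewrite leNgt (lt_le_trans HA eI).
by apply/mapP; exists (Bseq sI); rewrite ?mem_enum.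
Qed.

End Cuts.

(** * Covering families *)

Section Families.
Variables (R : realType) (T U : finType) (w : T -> R) (v : U -> R).
Hypothesis w01 : forall i, 0 < w i < 1.
Hypothesis w1 : \sum_i w i = 1.
Hypothesis v01 : forall j, 0 < v j < 1.
Hypothesis v1 : \sum_j v j = 1.
Variables (wlo vlo : R).
Hypothesis wloP : 0 < wlo < 1 /\ forall i, wlo <= w i.
Hypothesis vloP : 0 < vlo < 1 /\ forall j, vlo <= v j.

Definition lip_family N (L : 'I_N -> R) (g : 'I_N -> (nat -> T) -> nat -> U) :=
  forall i, 0 < L i /\ lip w v (L i) (g i).

Definition covers N (g : 'I_N -> (nat -> T) -> nat -> U) :=
  forall y, exists i x, g i x = y.

Lemma alphabet_inhabited (V : finType) (u : V -> R) :
  \sum_i u i = 1 -> inhabited V.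
Proof.
move=> u1; apply: contrapT => H; have : \sum_i u i = 0.
  by rewrite big1 // => i; case: H.
by rewrite u1 => /eqP; rewrite oner_eq0.
Qed.

Lemma lip_first_letter L (f : (nat -> T) -> nat -> U) I x x' :
  lip w v L f -> L * wt w I < 1 -> f (scat I x) 0%N = f (scat I x') 0%N.
Proof.
move=> fL LI; have := fL (scat I x) (scat I x') (size I + 0)%N 0%N.
rewrite prefix_wt_scat !prefix_wt0 mulr1 => H; apply: (H _ LI 0%N) => //.
exact/agree_scat/agree0.
Qed.

(** A piece [z] of a family is a member [z.1] precomposed with the word [z.2]; when
    its image lies in the cylinder of the letter [j], deleting this first letter
    magnifies the target by [(v j)^-1]. *)
Definition sub_ratio N (L : 'I_N -> R) (j : U) (z : 'I_N * seq T) : R :=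
  L z.1 * wt w z.2 / v j.

Definition sub_map N (g : 'I_N -> (nat -> T) -> nat -> U) (z : 'I_N * seq T) :
    (nat -> T) -> nat -> U :=
  fun x => sskip 1 (g z.1 (scat z.2 x)).

Lemma sub_map_lip N L (g : 'I_N -> (nat -> T) -> nat -> U) j z :
  lip w v (L z.1) (g z.1) -> (forall x, g z.1 (scat z.2 x) 0%N = j) ->
  lip w v (sub_ratio L j z) (sub_map g z).
Proof.
move=> gL gj x x' a b ag lt.
have /andP[vj0 _] := v01 j.
have := gL _ _ _ b.+1 (agree_scat (I := z.2) ag).
rewrite prefix_wt_scat prefix_wtS gj => /(_ _)/agreeS[|_ //].
move: lt; rewrite /sub_ratio /sub_map mulrAC ltr_pdivrMr // [_ * v j]mulrC.
by rewrite !mulrA.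
Qed.

(** Cutting every member at constant [vlo] < 1 makes the image of each piece lie
    in one first-letter cylinder; rescaling the pieces with first letter [j] gives
    a covering family for each [j], and the total mass is divided among these. *)
Lemma restrict_family N (L : 'I_N -> R) (g : 'I_N -> (nat -> T) -> nat -> U) :
  lip_family L g -> covers g ->
  exists (M : U -> nat) (src : forall j, 'I_(M j) -> 'I_N * seq T),
  [/\ forall j, lip_family (fun k => sub_ratio L j (src j k))
                           (fun k => sub_map g (src j k)) /\
                covers (fun k => sub_map g (src j k)),
      forall j k, sub_ratio L j (src j k) <= 1 /\
        ((src j k).2 = [::] \/ vlo * wlo <= sub_ratio L j (src j k)),
      forall j k x, g (src j k).1 (scat (src j k).2 x) 0%N = j,
      forall i x, exists k x',
        x = scat (src (g i x 0%N) k).2 x' /\ (src (g i x 0%N) k).1 = i &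
      \sum_j v j * \sum_k sub_ratio L j (src j k) = \sum_i L i].
Proof.
move=> gL gcov; have [t0] := alphabet_inhabited w1.
have [/andP[vlo0 vlo1] vloj] := vloP; have [/andP[wlo0 wlo1] wloi] := wloP.
have [S HS] := choice (fun i => cut_exists w01 w1 wloi (proj1 (gL i)) vlo0).
pose all_pieces := flatten (map (fun i => map (pair i) (S i)) (enum 'I_N)).
have in_all i I : ((i, I) \in all_pieces) = (I \in S i).
  apply/flatten_mapP/idP => [[i' _ /mapP[I' I'S [-> ->]]] //|IS].
  by exists i; [rewrite mem_enum|exact: map_f].
pose s j := [seq z <- all_pieces | g z.1 (scat z.2 (fun=> t0)) 0%N == j].
have sP j z : z \in s j -> z.2 \in S z.1 /\ forall x, g z.1 (scat z.2 x) 0%N = j.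
  rewrite mem_filter => /andP[/eqP gj]; case: z gj => i I gj; rewrite in_all.
  move=> IS; split=> // x; rewrite -gj.
  apply: (lip_first_letter _ _ (proj2 (gL i))).
  by have [_ /(_ _ IS)[H _] _] := HS i; apply: le_lt_trans vlo1.
exists (fun j => size (s j)), (fun j k => tnth (in_tuple (s j)) k).
have kP j k : tnth (in_tuple (s j)) k \in s j by apply: mem_tnth.
have reach i x : exists k x', x = scat (tnth (in_tuple (s (g i x 0%N))) k).2 x' /\
     (tnth (in_tuple (s (g i x 0%N))) k).1 = i.
  have [_ _ /(_ x) [I IS [x' xE]]] := HS i.
  have zs : (i, I) \in s (g i x 0%N).
    rewrite mem_filter in_all IS andbT; apply/eqP; rewrite xE.
    apply: (lip_first_letter _ _ (proj2 (gL i))).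
    by have [_ /(_ _ IS)[H _] _] := HS i; apply: le_lt_trans vlo1.
  have /tnthP [k kE] : (i, I) \in in_tuple (s (g i x 0%N)) by [].
  by exists k, x'; rewrite -kE.
split=> //.
- move=> j; split=> [k|y].
    have [_ gj] := sP _ _ (kP j k); have [L0 Lg] := gL (tnth (in_tuple (s j)) k).1.
    have /andP[vj0 _] := v01 j.
    by split; [rewrite divr_gt0 ?mulr_gt0 ?wt_gt0 | exact: sub_map_lip].
  have [i [x gx]] := gcov (scons j y).
  have := reach i x; rewrite gx /= => -[k [x' [xE ik]]].
  by exists k, x'; rewrite /sub_map ik -xE gx.
- move=> j k; have [IS _] := sP _ _ (kP j k).
  have [_ /(_ _ IS)[H1 H2] _] := HS (tnth (in_tuple (s j)) k).1.
  have /andP[vj0 vj1] := v01 j; rewrite /sub_ratio.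
  split; first by rewrite ler_pdivrMr // mul1r (le_trans H1).
  case: H2 => [H2|H2]; [by left|right].
  rewrite ler_pdivlMr //; apply: le_trans H2.
  by rewrite ger_pMr ?mulr_gt0 // ltW.
- by move=> j k x; have [_ ->] := sP _ _ (kP j k).
- transitivity (\sum_j \sum_(z <- s j) L z.1 * wt w z.2).
    apply: eq_bigr => j _; rewrite mulr_sumr (big_tnth _ _ (s j)).
    apply: eq_bigr => k _; rewrite /sub_ratio mulrCA divff ?mulr1 //.
    by have /andP[/lt0r_neq0] := v01 j.
  rewrite (eq_bigr (fun j => \sum_(z <- all_pieces)
      if g z.1 (scat z.2 (fun=> t0)) 0%N == j then L z.1 * wt w z.2 else 0));
    last by move=> j _; rewrite big_filter big_mkcond.
  rewrite exchange_big /= big_flatten /= big_map big_enum /=.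
  apply: eq_bigr => i _; rewrite big_map -[RHS]mulr1.
  have [<- _ _] := HS i; rewrite mulr_sumr; apply: eq_bigr => I _ /=.
  rewrite -big_mkcond /=.
  by apply: big_pred1 => j; rewrite /= eq_sym.
Qed.

(** The range of constants is stable under restriction: a member is cut only if its
    constant exceeds [vlo], into pieces of constant at least [vlo * wlo]. *)
Definition normal N (L : 'I_N -> R) (g : 'I_N -> (nat -> T) -> nat -> U) :=
  (forall i, vlo * wlo <= L i <= 1) /\ (forall i, lip w v (L i) (g i)).

Lemma low_gt0 : 0 < vlo * wlo.
Proof. by have [/andP[? _] _] := vloP; have [/andP[? _] _] := wloP; rewrite mulr_gt0. Qed.

Lemma normal_lip_family N (L : 'I_N -> R) g : normal L g -> lip_family L g.
Proof.
move=> [HL Hg] i; split=> //; have /andP[+ _] := HL i.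
exact: lt_le_trans low_gt0.
Qed.

Lemma average_le (f : U -> R) s : \sum_j v j * f j = s -> exists j, f j <= s.
Proof.
move=> fs; have [j0] := alphabet_inhabited v1; apply: contrapT => H.
have lt j : s < f j by rewrite ltNge; apply/negP => Hj; apply: H; exists j.
have : s < s; last by rewrite ltxx.
rewrite -{2}fs -{1}[s]mul1r -v1 mulr_suml.
have le j : v j * s <= v j * f j.
  by have /andP[vj0 _] := v01 j; rewrite ler_pM2l // ltW.
rewrite (bigD1 j0) //= [ltRHS](bigD1 j0) //= ltr_leD ?ler_sum //.
by have /andP[vj0 _] := v01 j0; rewrite ltr_pM2l.
Qed.

(** Restriction to a letter chosen by averaging does not increase the mass, and
    members too light to be cut are enlarged by a definite factor, so finitely
    many restrictions bring all the constants into a fixed range. *)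
Lemma normalize N (L : 'I_N -> R) g : lip_family L g -> covers g ->
  exists N' (L' : 'I_N' -> R) g',
    [/\ normal L' g', covers g' & \sum_i L' i <= \sum_i L i].
Proof.
have [lo [hi [_ _ hi0 hi1 vhi]]] := weight_bounds v01.
have [/andP[vlo0 vlo1] vloj] := vloP.
move=> gL gcov.
have [k Hk] : exists k, forall i, vlo * wlo * hi ^+ k <= L i.
  suff [k Hk] : exists k, forall i, i \in enum 'I_N -> vlo * wlo * hi ^+ k <= L i.
    by exists k => i; apply: Hk; rewrite mem_enum.
  elim: (enum _) => [|i s [k Hk]]; first by exists 0%N.
  have [L0 _] := gL i; have h01 : 0 < hi < 1 by rewrite hi0.
  have [k' Hk'] := expr_small h01 (divr_gt0 L0 low_gt0).
  have cc := low_gt0; have hp a : 0 < hi ^+ a by rewrite exprn_gt0.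
  exists (maxn k k') => i'; rewrite inE => /orP[/eqP ->|/Hk Hi'].
    move: Hk'; rewrite ltr_pdivlMr // mulrC => /ltW; apply: le_trans.
    by rewrite ler_pM2l // ler_wiXn2l ?leq_maxr // ltW.
  apply: le_trans Hi'.
  by rewrite ler_pM2l // ler_wiXn2l ?leq_maxl // ltW.
elim: k N L g gL gcov Hk => [|k IHk] N L g gL gcov Hk;
  have [M [src [H1 H2 _ _ H5]]] := restrict_family gL gcov;
  have [j Hj] := average_le H5; have [lipj covj] := H1 j;
  have /andP[vj0 vj1] := v01 j.
  exists (M j), (fun k => sub_ratio L j (src j k)), (fun k => sub_map g (src j k)).
  split=> //; split=> i; last by have [] := lipj i.
  have [-> H] := H2 j i; rewrite andbT; case: H => [H|//].
  rewrite /sub_ratio H wt_nil mulr1 ler_pdivlMr //.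
  by apply: le_trans (Hk (src j i).1); rewrite mulr1 ger_pMr ?low_gt0 // ltW.
have Hk' i : vlo * wlo * hi ^+ k <= sub_ratio L j (src j i).
  have [_ H] := H2 j i; case: H => [H|H].
    rewrite /sub_ratio H wt_nil mulr1 ler_pdivlMr //.
    apply: le_trans (Hk (src j i).1); rewrite exprSr mulrA.
    rewrite ler_pM2l; last by rewrite (mulr_gt0 low_gt0) // exprn_gt0.
    by have /andP[] := vhi j.
  by apply: le_trans H; rewrite ger_pMr ?low_gt0 // exprn_ile1 // ltW.
have [N' [L' [g' [norm' cov' le']]]] := IHk _ _ _ lipj covj Hk'.
by exists N', L', g'; split=> //; apply: le_trans Hj.
Qed.

Definition masses : set R := [set mu | exists N (L : 'I_N -> R) g,
  [/\ normal L g, covers g & mu = \sum_i L i]].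

Definition min_mass : R := inf masses.

Lemma masses_ge0 mu : masses mu -> 0 <= mu.
Proof.
move=> [N [L [g [nL _ ->]]]]; apply: sumr_ge0 => i _.
by have [/ltW] := normal_lip_family nL i.
Qed.

Lemma min_mass_le N (L : 'I_N -> R) g : lip_family L g -> covers g ->
  min_mass <= \sum_i L i.
Proof.
move=> gL gcov; have [N' [L' [g' [norm' cov' le']]]] := normalize gL gcov.
apply: le_trans le'; apply: ge_inf; first by exists 0 => mu /masses_ge0.
by exists N', L', g'.
Qed.

Lemma min_mass_sub N (L : 'I_N -> R) g (A : {set 'I_N}) : lip_family L g ->
  (forall y, exists i x, i \in A /\ g i x = y) ->
  min_mass <= \sum_(i in A) L i.
Proof.
move=> gL gcov; rewrite big_enum_val /=.
apply: (min_mass_le (g := fun k => g (enum_val k))) => [k|y]; first exact: gL.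
have [i [x [iA gx]]] := gcov y.
by exists (enum_rank_in iA i), x; rewrite enum_rankK_in.
Qed.

Lemma normal_card N (L : 'I_N -> R) g B : normal L g -> \sum_i L i <= B ->
  (N <= Num.bound (B / (vlo * wlo)))%N.
Proof.
move=> [HL _] HB; have cc := low_gt0.
have : N%:R * (vlo * wlo) <= B.
  apply: le_trans HB; rewrite -[N in N%:R]card_ord -sum1_card natr_sum mulr_suml.
  by apply: ler_sum => i _; rewrite mul1r; have /andP[] := HL i.
rewrite -ler_pdivlMr // => H; rewrite -(ler_nat R).
apply: ltW; apply: (le_lt_trans H).
by apply: archi_boundP; apply: le_trans H.
Qed.

(** Compactness: the constants converge along an ultrafilter in a compact
    interval, the maps letter by letter. *)
Lemma limit_family N (L : nat -> 'I_N -> R) (g : nat -> 'I_N -> (nat -> T) -> nat -> U)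
    (A : {set 'I_N}) (mu : R) :
  (forall k, normal (L k) (g k)) ->
  (forall k y, exists i x, i \in A /\ agree k (g k i x) y) ->
  (forall e, 0 < e -> exists K, forall k, (K <= k)%N -> \sum_i L k i <= mu + e) ->
  exists (L' : 'I_N -> R) g', [/\ normal L' g',
    forall y, exists i x, i \in A /\ g' i x = y & \sum_i L' i <= mu].
Proof.
move=> norm dense mass; have [F [FU Foo]] := ultra_oo.
have cc := low_gt0.
have exL i : exists l, vlo * wlo <= l <= 1 /\
    forall e, 0 < e -> F [set k | `|l - L k i| < e].
  have [|l Xl Hl] := ultra_limit_compact (p := fun k => L k i) FU
    (@segment_compact R (vlo * wlo) 1).
    by move=> k; rewrite /= in_itv /=; have [/(_ i)] := norm k.
  exists l; split; first by move: Xl; rewrite /= in_itv.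
  by move=> e e0; have := Hl (ball l e) (nbhsx_ballx l e e0); rewrite -ball_normE.
have [L' HL'] := choice exL.
have /choice [g' near_g] i : exists h : (nat -> T) -> nat -> U,
    forall x b, F [set k | agree b (g k i x) (h x)].
  by have [h Hh] := choice (fun x => ultra_limit_seq (fun k => g k i x) FU); exists h.
have FF : Filter F by exact: _.
have and2 A1 A2 : F A1 -> F A2 -> F (A1 `&` A2) by apply: filterI.
have meet2 A1 A2 : F A1 -> F A2 -> exists k, A1 k /\ A2 k.
  by move=> F1 F2; have /filter_ex [k [k1 k2]] := and2 _ _ F1 F2; exists k.
have lip' i : lip w v (L' i) (g' i).
  move=> x x' a b ag lt; have [_ /(_ _) Hnear] := HL' i.
  pose e := (prefix_wt v (g' i x) b - L' i * prefix_wt w x a).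
  have e0 : 0 < e by rewrite subr_gt0.
  have [k [[Hk1 Hk2] Hk3]] := meet2 _ _ (and2 _ _ (near_g i x b.+1)
    (near_g i x' b.+1)) (Hnear e e0).
  apply: agree_trans (agree_sym Hk1) _; apply: agree_trans Hk2.
  have [_ /(_ i)] := norm k; apply; first exact: ag.
  rewrite (agree_prefix_wt v (agree_le (leqnSn b) Hk1)).
  move: Hk3; rewrite /= ltr_distl => /andP[Hk3 _].
  have p0 := prefix_wt_gt0 w01 x a; have p1 := prefix_wt_le1 w01 x a.
  have : (L k i - L' i) * prefix_wt w x a < e; last by rewrite /e; lra.
  have [Hle|Hgt] := leP (L k i) (L' i); last by nra.
  by apply: le_lt_trans e0; rewrite mulr_le0_ge0 ?subr_le0 // ltW.
exists L', g'; split.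
- by split=> i; [have [] := HL' i | exact: lip'].
- (* The approximate preimages [x k] of [y] converge to a preimage, because the
     maps have a common Lipschitz constant. *)
  move=> y; have [ix Hix] := choice (fun k => dense k y).
  have [x Hx] := choice Hix.
  have [i Hi] := ultra_limit_fin ix FU.
  have [xl near_x] := ultra_limit_seq x FU.
  exists i, xl; split.
    by have [k [<- _]] := meet2 _ _ Hi (Foo 0%N); have [] := Hx k.
  apply: agree_all => b.
  have [a Ha] := prefix_wt_small w01 (prefix_wt_gt0 v01 y b).
  have [k [[[H1 H2] H3] H4]] := meet2 _ _ (and2 _ _ (and2 _ _ Hi
    (near_x a)) (Foo b)) (near_g i xl b).
  have [_ Hy] := Hx k; rewrite {}H1 in Hy.
  apply: agree_trans (agree_sym H4) _.
  apply: agree_trans (agree_le H3 Hy); apply: agree_sym.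
  have [HL /(_ i) Hlip] := norm k; have /andP[_ Li] := HL i.
  apply: agree_le (leqnSn b) _; apply: Hlip H2 _.
  rewrite (agree_prefix_wt v (agree_le H3 Hy)); apply: le_lt_trans (Ha (x k)).
  by rewrite ger_pMl // prefix_wt_gt0.
- apply/ler_addgt0Pr => e e0.
  have N0 : 0 < (N.+1%:R : R) by rewrite ltr0n.
  have e20 : 0 < e / 2 by rewrite divr_gt0.
  have [K HK] := mass _ e20.
  have [k [H1 H2]] := meet2 _ _ (Foo K) (filter_forall _
    (fun i => proj2 (HL' i) _ (divr_gt0 e20 N0))).
  have le i : L' i <= L k i + e / 2 / N.+1%:R.
    by have := H2 i; rewrite /= ltr_distl => /andP[_ /ltW].
  have /le_trans -> // : \sum_i L' i <= \sum_i (L k i + e / 2 / N.+1%:R).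
    by apply: ler_sum.
  rewrite big_split /= sumr_const card_ord.
  apply: (le_trans (lerD (HK _ H1) (lexx _))).
  rewrite [in leRHS](splitr e) addrA lerD2l -[_ *+ N]mulr_natr.
  by rewrite mulrAC ler_pdivrMr // ler_pM2l // ler_nat.
Qed.

Definition optimal N (L : 'I_N -> R) (g : 'I_N -> (nat -> T) -> nat -> U) :=
  [/\ normal L g, covers g & \sum_i L i = min_mass].

(** If each of finitely many alternatives failed from some [k] on, they would all
    fail together. *)
Lemma pigeonhole_monotone (I : finType) (P : I -> nat -> Prop) :
  (forall i k k', (k <= k')%N -> P i k' -> P i k) ->
  (forall k, exists i, P i k) -> exists i, forall k, P i k.
Proof.
move=> mono H; apply: contrapT => Hn.
have /choice [K HK] i : exists k, ~ P i k.
  by apply: contrapT => Hi; apply: Hn; exists i => k; apply: contrapT => Hk;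
     apply: Hi; exists k.
have [i Hi] := H (\max_i K i); apply: (HK i); apply: mono Hi.
exact: leq_bigmax.
Qed.

(** Members of normal families have constants bounded below, so those of bounded mass
    have boundedly many members; families of a fixed size approaching the infimum
    then have a limit. *)
Lemma optimal_exists N0 (L0 : 'I_N0 -> R) g0 : lip_family L0 g0 -> covers g0 ->
  exists N (L : 'I_N -> R) g, optimal L g.
Proof.
move=> gL gcov; have infm : has_inf masses.
  split; last by exists 0 => mu /masses_ge0.
  have [N' [L' [g' [norm' cov' _]]]] := normalize gL gcov.
  by exists (\sum_i L' i), N', L', g'.
pose B := Num.bound ((min_mass + 1) / (vlo * wlo)).
pose P (n : 'I_B.+1) k := exists (L : 'I_n -> R) g,
  [/\ normal L g, covers g & \sum_i L i <= min_mass + k.+1%:R^-1].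
have [n Hn] : exists n, forall k, P n k.
  apply: pigeonhole_monotone.
    move=> n k k' kk' [L [g [nL cg le]]]; exists L, g; split=> //.
    apply: le_trans le _; rewrite lerD2l lef_pV2 ?posrE ?ltr0n //.
    by rewrite ler_nat.
  move=> k; have k0 : 0 < (k.+1%:R : R)^-1 by rewrite invr_gt0 ltr0n.
  have [mu [N [L [g [nL cg ->]]]] /ltW le] := inf_adherent k0 infm.
  have NB : (N < B.+1)%N.
    rewrite ltnS; apply: (normal_card nL); apply: le_trans le _.
    by rewrite lerD2l invf_le1 ?ltr0n // ler1n.
  by exists (Ordinal NB), L, g.
have [L HL] := choice Hn; have [g Hg] := choice HL.
have [L' [g' [nL' cov' le']]] : exists (L' : 'I_n -> R) g', [/\ normal L' g',
    forall y, exists i x, i \in [set: 'I_n]%SET /\ g' i x = y &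
    \sum_i L' i <= min_mass].
  apply: (limit_family (L := L) (g := g)).
  - by move=> k; have [] := Hg k.
  - move=> k y; have [_ /(_ y) [i [x <-]] _] := Hg k.
    by exists i, x; rewrite finset.in_setT.
  - move=> e e0; exists (Num.bound e^-1) => k Kk.
    have [_ _ /le_trans] := Hg k; apply; rewrite lerD2l.
    rewrite -[leRHS]invrK lef_pV2 ?posrE ?invr_gt0 ?ltr0n //.
    have /archi_boundP /ltW /le_trans : 0 <= e^-1 by rewrite invr_ge0 ltW.
    by apply; rewrite ler_nat (leq_trans Kk).
have cg' : covers g' by move=> y; have [i [x [_ <-]]] := cov' y; exists i, x.
exists n, L', g'; split=> //; apply/eqP; rewrite eq_le le' /=.
exact/min_mass_le/cg'/normal_lip_family.
Qed.

(** The restricted families have an average mass equal to the minimum, hence each of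
    them is minimal. *)
Lemma restrict_optimal N (L : 'I_N -> R) g : optimal L g ->
  exists (M : U -> nat) (src : forall j, 'I_(M j) -> 'I_N * seq T),
  [/\ forall j, optimal (fun k => sub_ratio L j (src j k))
                        (fun k => sub_map g (src j k)),
      forall j k, vlo * wlo * vlo <= wt w (src j k).2,
      forall j k x, g (src j k).1 (scat (src j k).2 x) 0%N = j &
      forall i x, exists k x',
        x = scat (src (g i x 0%N) k).2 x' /\ (src (g i x 0%N) k).1 = i].
Proof.
move=> [nL cg massE]; have lg := normal_lip_family nL.
have [M [src [H1 H2 H3 H4 H5]]] := restrict_family lg cg.
have cc := low_gt0; have [/andP[vlo0 vlo1] vloj] := vloP.
have lo j k : vlo * wlo <= sub_ratio L j (src j k).
  have [_ [H|//]] := H2 j k; have /andP[vj0 vj1] := v01 j.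
  have [/(_ (src j k).1) /andP[HL _] _] := nL.
  rewrite /sub_ratio H wt_nil mulr1 ler_pdivlMr //.
  by apply: le_trans HL; rewrite ger_pMr // ltW.
have nj j : normal (fun k => sub_ratio L j (src j k)) (fun k => sub_map g (src j k)).
  split=> k; last by have [/(_ k) []] := H1 j.
  by rewrite lo; have [] := H2 j k.
have le j : min_mass <= \sum_k sub_ratio L j (src j k).
  by apply: min_mass_le (H1 j).2; exact: (H1 j).1.
exists M, src; split=> // [j|j k]; last first.
  have := lo j k; rewrite /sub_ratio; have /andP[vj0 vj1] := v01 j.
  rewrite ler_pdivlMr // => Hlo; have /andP[_ L1] := nL.1 (src j k).1.
  have p0 := wt_gt0 w01 (src j k).2; have vj := vloj j.
  have : vlo * wlo * vlo <= vlo * wlo * v j by rewrite ler_pM2l.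
  by move=> /le_trans; apply; apply: le_trans Hlo _; rewrite ger_pMl.
split=> //; first by have [] := H1 j.
have : \sum_j v j * (\sum_k sub_ratio L j (src j k) - min_mass) = 0.
  under eq_bigr do rewrite mulrBr.
  by rewrite sumrB H5 massE -mulr_suml v1 mul1r subrr.
have ge0 j' : true -> 0 <= v j' * (\sum_k sub_ratio L j' (src j' k) - min_mass).
  by move=> _; have /andP[/ltW vj0 _] := v01 j'; rewrite mulr_ge0 // subr_ge0.
move=> /eqP; rewrite psumr_eq0 // => /allP /(_ j); rewrite mem_index_enum.
move=> /(_ isT) /=; rewrite mulf_eq0 subr_eq0 => /orP[|/eqP //].
by have /andP[/lt0r_neq0 /negPf ->] := v01 j.
Qed.

(** No member of an optimal family can be dispensed with, since the others have
    a smaller mass; by compactness this is visible at a uniform depth. *)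
Lemma optimal_irredundant : exists D, forall N (L : 'I_N -> R) g, optimal L g ->
  forall i, exists y, forall i' x, i' != i -> ~ agree D (g i' x) y.
Proof.
apply: contrapT => H.
pose B := Num.bound (min_mass / (vlo * wlo)).
pose P0 N (i : 'I_N) D := exists (L : 'I_N -> R) g, optimal L g /\
    forall y, exists i' x, i' != i /\ agree D (g i' x) y.
have mono N (i : 'I_N) k k' : (k <= k')%N -> P0 N i k' -> P0 N i k.
  move=> kk' [L [g [opt H']]]; exists L, g; split=> // y.
  by have [i' [x [ne ag]]] := H' y; exists i', x; split=> //; apply: agree_le ag.
have [n Hn] : exists n : 'I_B.+1, forall D, exists i, P0 n i D.
  apply: (pigeonhole_monotone (P := fun n : 'I_B.+1 => fun D => exists i, P0 n i D)).
    by move=> n k k' kk' [i Hi]; exists i; apply: mono Hi.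
  move=> D; apply: contrapT => HD; apply: H; exists D => N L g opt i.
  have NB : (N < B.+1)%N.
    by have [nL _ mE] := opt; rewrite ltnS; apply: (normal_card nL); rewrite mE.
  apply: contrapT => Hy; apply: HD; exists (Ordinal NB), i, L, g; split=> // y.
  apply: contrapT => Hi; apply: Hy; exists y => i' x ne ag; apply: Hi.
  by exists i', x.
have [i Hi] := pigeonhole_monotone (mono n) Hn.
have [L HL] := choice Hi; have [g Hg] := choice HL.
have [L' [g' [nL' cov' le']]] : exists (L' : 'I_n -> R) g', [/\ normal L' g',
    forall y, exists i' x, i' \in [set~ i]%SET /\ g' i' x = y &
    \sum_i L' i <= min_mass].
  apply: (limit_family (L := L) (g := g)).
  - by move=> k; have [[]] := Hg k.
  - move=> k y; have [_ /(_ y) [i' [x [ne ag]]]] := Hg k.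
    by exists i', x; rewrite finset.in_setC1.
  - by move=> e e0; exists 0%N => k _; have [[_ _ ->] _] := Hg k; rewrite lerDl ltW.
have := min_mass_sub (normal_lip_family nL') cov'.
have [L'0 _] := normal_lip_family nL' i.
rewrite leNgt; apply/negP/negPn; apply: lt_le_trans le'.
rewrite [ltRHS](bigD1 i) //= (eq_bigl (fun j => j != i)).
  by rewrite ltrDr.
by move=> j; rewrite finset.in_setC1.
Qed.

Lemma finite_sums (Q : seq R) (B : nat) : exists S : seq R,
  forall n (u : 'I_n -> R), (n <= B)%N -> (forall i, u i \in Q) ->
    \sum_i u i \in S.
Proof.
elim: B => [|B [S HS]].
  by exists [:: 0] => n u; rewrite leqn0 => /eqP n0; subst n; rewrite big_ord0 inE.
exists (0 :: [seq q + s | q <- Q, s <- S]) => -[|n] u nB uQ.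
  by rewrite big_ord0 inE eqxx.
by rewrite big_ord_recl inE allpairs_f ?orbT //; apply: HS.
Qed.

(** If only the members in [A] reach a cylinder, then restricting to that
    cylinder leaves pieces of them only, and the mass of the restricted family,
    which is the minimal one, determines their common scale [l].  The relative
    sizes [Q] of the members remain in a finite set under restriction, because the
    pieces of a normal family come from heavy words. *)
Lemma finite_scales D (Q : seq R) : exists E : seq R,
  forall N (L : 'I_N -> R) g (A : {set 'I_N}) l, optimal L g -> 0 < l ->
    (forall i, i \in A -> exists2 u, u \in Q & L i = l * u) ->
    (exists y, forall i x, i \notin A -> ~ agree D (g i x) y) -> l \in E.
Proof.
elim: D Q => [|D IHD] Q.
  have [S HS] := finite_sums Q (Num.bound (min_mass / (vlo * wlo))).
  exists [seq min_mass / s | s <- S] => N L g A l opt l0 HA [y Hy].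
  have [t0] := alphabet_inhabited w1.
  have /choice [u Hu] i : exists u, u \in Q /\ L i = l * u.
    have [iA|niA] := boolP (i \in A); first by have [u] := HA i iA; exists u.
    by case: (Hy i (fun=> t0) niA).
  have [nL cg mE] := opt.
  have uS : \sum_i u i \in S.
    by apply: HS => [|i]; [apply: (normal_card nL); rewrite mE | have [] := Hu i].
  have lu : l * \sum_i u i = min_mass.
    by rewrite mulr_sumr -mE; apply: eq_bigr => i _; have [_ ->] := Hu i.
  apply/mapP; exists (\sum_i u i) => //; rewrite -lu mulfK //.
  have [i0 [_ _]] := cg y; have : 0 < min_mass.
    rewrite -mE (bigD1 i0) //= ltr_pwDl ?sumr_ge0 // => [|i _].
      by have [] := normal_lip_family nL i0.
    by have [/ltW] := normal_lip_family nL i.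
  by rewrite -lu; case: eqP => // ->; rewrite mulr0 ltxx.
have [/andP[vlo0 _] _] := vloP.
have [Wc HWc] := heavy_words_finite w01 (mulr_gt0 low_gt0 vlo0).
have [E HE] := IHD [seq x / v j | x <- [seq u * t | u <- Q, t <- Wc], j <- enum U].
exists E => N L g A l opt l0 HA [y Hy].
have [M [src [H1 H2 H3 _]]] := restrict_optimal opt.
apply: (HE _ _ _ [set k | (src (y 0%N) k).1 \in A]%SET l (H1 (y 0%N)) l0).
  move=> k; rewrite inE => kA; have [u uQ Lu] := HA _ kA.
  exists (u * wt w (src (y 0%N) k).2 / v (y 0%N)).
    apply/allpairsP; exists (u * wt w (src (y 0%N) k).2, y 0%N).
    split; rewrite ?mem_enum //=; apply/allpairsP.
    by exists (u, wt w (src (y 0%N) k).2); split; rewrite ?HWc.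
  by rewrite /sub_ratio Lu !mulrA.
exists (sskip 1 y) => k x; rewrite inE => kA ag.
apply: (Hy _ (scat (src (y 0%N) k).2 x) kA).
by apply/agreeS; rewrite H3.
Qed.

Lemma optimal_ratios_finite : exists E : seq R,
  forall N (L : 'I_N -> R) g, optimal L g -> forall i, L i \in E.
Proof.
have [D HD] := optimal_irredundant; have [E HE] := finite_scales D [:: 1].
exists E => N L g opt i; have [nL _ _] := opt.
have [Li _] := normal_lip_family nL i.
apply: (HE _ _ _ [set i]%SET _ opt Li).
  by move=> i'; rewrite finset.in_set1 => /eqP ->; exists 1; rewrite ?inE ?mulr1.
have [y Hy] := HD _ _ _ opt i; exists y => i' x; rewrite finset.in_set1; exact: Hy.
Qed.

(** Restricting successively to the letters of [g0 i0 x], one keeps track of the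
    piece that contains [x]. *)
Lemma optimal_chain N0 (L0 : 'I_N0 -> R) g0 i0 x k : optimal L0 g0 ->
  exists N (L : 'I_N -> R) g i a, [/\ optimal L g,
    L i * prefix_wt v (g0 i0 x) k = L0 i0 * prefix_wt w x a &
    g i (sskip a x) = sskip k (g0 i0 x)].
Proof.
move=> opt0; elim: k => [|k [N [L [g [i [a [opt Li gi]]]]]]].
  by exists N0, L0, g0, i0, 0%N; split=> //; rewrite !prefix_wt0.
have [M [src [H1 _ _ H4]]] := restrict_optimal opt.
have [k' [x' [xE iE]]] := H4 i (sskip a x).
set j := g i (sskip a x) 0%N in k' xE iE.
exists (M j), (fun k => sub_ratio L j (src j k)), (fun k => sub_map g (src j k)), k'.
exists (a + size (src j k').2)%N; split=> //.
  have jE : j = sskip k (g0 i0 x) 0%N by rewrite /j gi.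
  rewrite -addn1 !prefix_wtD prefix_wtS prefix_wt0 -jE xE /sub_ratio iE mulr1.
  have := prefix_wt_scat w (src j k').2 x' 0; rewrite addn0 prefix_wt0 mulr1 => ->.
  rewrite [RHS]mulrA -Li; have /andP[/lt0r_neq0 vj0 _] := v01 j.
  by field.
rewrite /sub_map iE -sskip_add xE sskip_scat -xE gi sskip_add.
by rewrite addn1.
Qed.

End Families.

(** The relation [P] links a sequence to its images under the members of an
    optimal family.  Along such a pair the quotients of prefix weights are, up to a
    constant factor, Lipschitz constants of members of optimal families, which
    take finitely many values: two of these quotients coincide. *)
Theorem surjection_weight_relation (R : realType) (T U : finType) (w : T -> R)
    (v : U -> R) L f : probability_vector w -> probability_vector v ->
  0 < L -> lip w v L f -> (forall y, exists x, f x = y) ->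
  exists P : (nat -> T) -> (nat -> U) -> Prop,
  [/\ forall x, exists y, P x y, forall y, exists x, P x y &
   forall x y, P x y -> exists a a' k k', (k < k')%N /\
     prefix_wt v y k' * prefix_wt w x a = prefix_wt v y k * prefix_wt w x a'].
Proof.
move=> [w01 w1] [v01 v1] L0 fL fsurj.
have [wlo [whi [wlo0 wlo1 _ _ Hw]]] := weight_bounds w01.
have [vlo [vhi [vlo0 vlo1 _ _ Hv]]] := weight_bounds v01.
have wloP : 0 < wlo < 1 /\ forall i, wlo <= w i.
  by split=> [|i]; [rewrite wlo0 | have /andP[] := Hw i].
have vloP : 0 < vlo < 1 /\ forall i, vlo <= v i.
  by split=> [|i]; [rewrite vlo0 | have /andP[] := Hv i].
have lf : lip_family w v (fun _ : 'I_1 => L) (fun=> f) by [].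
have cf : covers (fun _ : 'I_1 => f).
  by move=> y; have [x <-] := fsurj y; exists ord0, x.
have [N0 [L0' [g0 opt0]]] := optimal_exists w01 w1 v01 v1 wloP vloP lf cf.
have [E HE] := optimal_ratios_finite w01 w1 v01 v1 wloP vloP.
exists (fun x y => exists i, g0 i x = y); split.
- have [u0] := alphabet_inhabited v1; have [_ cg _] := opt0.
  by have [i _] := cg (fun=> u0); move=> x; exists (g0 i x), i.
- by move=> y; have [_ cg _] := opt0; have [i [x gx]] := cg y; exists x, i.
move=> x y [i0 gy].
have Hk k : exists al : nat * R, al.2 \in E /\
    al.2 * prefix_wt v y k = L0' i0 * prefix_wt w x al.1.
  have [N [L' [g [i [a [opt Li _]]]]]] :=
    optimal_chain w01 w1 v01 v1 wloP vloP i0 x k opt0.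
  by exists (a, L' i); rewrite -gy; split=> //=; apply: HE opt i.
have [al Hal] := choice Hk.
pose s := [seq (al k).2 | k <- iota 0 (size E).+1].
have : ~~ uniq s.
  apply/negP => us; have : (size s <= size E)%N.
    by apply: uniq_leq_size us _ => _ /mapP [k _ ->]; have [] := Hal k.
  by rewrite size_map size_iota ltnn.
move=> /(uniqPn 0) [k [k' [kk']]]; rewrite size_map size_iota => k's.
rewrite !(nth_map 0%N) ?size_iota ?(ltn_trans kk') // !nth_iota ?(ltn_trans kk') //.
rewrite !add0n => alE; exists (al k).1, (al k').1, k, k'; split=> //.
have [_ e1] := Hal k; have [_ e2] := Hal k'; rewrite -alE in e2.
have [nL _ _] := opt0.
have [Li _] := normal_lip_family wloP vloP nL i0.
apply: (mulfI (lt0r_neq0 Li)); rewrite mulrCA -e1 [RHS]mulrCA -e2.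
by rewrite mulrCA [RHS]mulrCA [X in _ = _ * X]mulrC.
Qed.

(** * Commensurable weights *)

Section CommonBase.
Variable R : realType.
Implicit Types (p q z : R).

Definition powers_of q (I : finType) (z : I -> R) : Prop :=
  forall i, exists k, z i = q ^+ k.

Lemma expr_inj01 q a b : 0 < q < 1 -> q ^+ a < q ^+ b -> (b < a)%N.
Proof.
move=> /andP[q0 q1] lt; rewrite ltnNge; apply/negP => ab.
by move: lt; rewrite ltNge ler_wiXn2l // ltW.
Qed.

(** The root of [p] of order the product of all the exponents [a] works. *)
Lemma common_root (I : finType) (z : I -> R) p : 0 < p < 1 ->
  (forall i, 0 < z i < 1) ->
  (forall i, exists a b, (0 < a)%N /\ z i ^+ a = p ^+ b) ->
  exists q, [/\ 0 < q < 1, exists K, p = q ^+ K & powers_of q z].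
Proof.
move=> /andP[p0 p1] z01 /choice [a /choice [b Hab]].
pose A := (\prod_i a i)%N.
have A0 : (0 < A)%N by apply: prodn_gt0 => i; have [] := Hab i.
have qA : (p `^ A%:R^-1) ^+ A = p.
  by rewrite -powR_mulrn ?powR_ge0 // -powRrM mulVf ?powRr1 ?ltW // pnatr_eq0 -lt0n.
have q0 : 0 < p `^ A%:R^-1 by rewrite powR_gt0.
exists (p `^ A%:R^-1); split; last 2 first.
- by exists A.
- move=> i; have [ai0 zp] := Hab i; have /andP[zi0 _] := z01 i.
  have /dvdnP [c Ac] : (a i %| A)%N by rewrite /A (bigD1 i) //= dvdn_mulr.
  exists (c * b i)%N; apply/eqP; rewrite -(eqrXn2 ai0) ?exprn_ge0 // ?ltW //.
  by rewrite zp -{1}qA -!exprM Ac; apply/eqP; congr (_ ^+ _); lia.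
rewrite q0 /= ltNge; apply/negP => q1.
by move: p1; rewrite -qA ltNge exprn_ege1.
Qed.

(** As [z ^+ (c' - c)] is less than 1, the exponents of [p] differ too. *)
Lemma power_relation z p c c' m m' : 0 < z < 1 -> 0 < p < 1 -> (c < c')%N ->
  z ^+ c' * p ^+ m = z ^+ c * p ^+ m' ->
  exists a b, (0 < a)%N /\ z ^+ a = p ^+ b.
Proof.
move=> z01 p01 cc' e; have /andP[z0 z1] := z01; have /andP[p0 p1] := p01.
have cE : c' = (c + (c' - c))%N by rewrite subnKC // ltnW.
have e2 : z ^+ (c' - c) * p ^+ m = p ^+ m'.
  apply: (@mulfI _ (z ^+ c)); first by rewrite lt0r_neq0 // exprn_gt0.
  by rewrite mulrA -exprD -cE.
have zlt : z ^+ (c' - c) < 1 by rewrite exprn_ilt1 ?ltW // -lt0n subn_gt0.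
have mm' : (m < m')%N.
  by apply: (expr_inj01 p01); rewrite -e2 gtr_pMl // exprn_gt0.
exists (c' - c)%N, (m' - m)%N; rewrite subn_gt0; split=> //.
apply: (@mulIf _ (p ^+ m)); first by rewrite lt0r_neq0 // exprn_gt0.
by rewrite e2 -exprD subnK // ltnW.
Qed.

Lemma prefix_wt_power (I : finType) (z : I -> R) q x a : powers_of q z ->
  exists k, prefix_wt z x a = q ^+ k.
Proof.
move=> H; elim: a x => [|a IHa] x; first by exists 0%N; rewrite prefix_wt0.
have [k kE] := IHa (sskip 1 x); have [k0 k0E] := H (x 0%N).
by exists (k0 + k)%N; rewrite prefix_wtS kE k0E exprD.
Qed.

Lemma powers_of_root (I : finType) (z : I -> R) p q K :
  p = q ^+ K -> powers_of p z -> powers_of q z.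
Proof. by move=> -> H i; have [k ->] := H i; exists (K * k)%N; rewrite exprM. Qed.

(** On the side known to consist of powers of [p], all prefix weights are powers of
    [p]; on the other side, constant sequences have the powers of one weight as
    prefix weights. *)
Lemma common_base (T U : finType) (w : T -> R) (v : U -> R) L f p :
  probability_vector w -> probability_vector v -> 0 < L -> lip w v L f ->
  (forall y, exists x, f x = y) -> 0 < p < 1 ->
  powers_of p w \/ powers_of p v ->
  exists q, [/\ 0 < q < 1, powers_of q w & powers_of q v].
Proof.
move=> pw pv L0 fL fsurj p01 H.
have [P [Pl Pr HP]] := surjection_weight_relation pw pv L0 fL fsurj.
have [[w01 _] [v01 _]] := (pw, pv).
case: H => Hp.
  have [|q [q01 [K pK] vq]] := @common_root U v p p01 v01.
    move=> j; have [x /HP [a [a' [k [k' [kk']]]]]] := Pr (fun=> j).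
    have [m ->] := prefix_wt_power x a Hp; have [m' ->] := prefix_wt_power x a' Hp.
    by rewrite !wt_const_prefix; apply: power_relation.
  by exists q; split=> //; apply: powers_of_root pK Hp.
have [|q [q01 [K pK] wq]] := @common_root T w p p01 w01.
  move=> i; have [y /HP [a [a' [k [k' [kk']]]]]] := Pl (fun=> i).
  have lt := prefix_wt_lt v01 y kk' => e.
  have aa' : (a < a')%N.
    apply: (@lt_prefix_wt _ _ w w01 (fun=> i)).
    have p0 := prefix_wt_gt0 w01 (fun=> i) a.
    have V0 := prefix_wt_gt0 v01 y k.
    rewrite -(ltr_pM2l V0) -e ltr_pM2r //.
  move: e; have [m ->] := prefix_wt_power y k Hp.
  have [m' ->] := prefix_wt_power y k' Hp.
  rewrite !wt_const_prefix => e; apply: (power_relation (m := m) (m' := m') (w01 i) p01 aa').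
  by rewrite [LHS]mulrC -e mulrC.
by exists q; split=> //; apply: powers_of_root pK Hp.
Qed.

Lemma commensurable_powers (I : finType) (z : I -> R) :
  (forall i, 0 < z i < 1) -> commensurable (range z) ->
  exists2 q, 0 < q < 1 & powers_of q z.
Proof.
move=> z01 comm.
have [i0 _|none] := pickP I; last first.
  by exists 2^-1; [lra | move=> i; have := none i].
have [|q [q01 _ zq]] := common_root (z01 i0) z01; last by exists q.
move=> i; have [c Hc] : exists c, ln (z i) / ln (z i0) = ratr c.
  by apply: comm; [exists i | exists i0].
have ln0 i' : ln (z i') < 0 by apply: ln_lt0.
have c0 : 0 < c.
  by rewrite -(ltr0q R) -Hc nmulr_rgt0 // invr_lt0.
have zi0 : 0 < z i by have /andP[] := z01 i.
have z00 : 0 < z i0 by have /andP[] := z01 i0.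
have numE : numq c = `|numq c|%N :> int by rewrite gez0_abs // numq_ge0 ltW.
exists `|denq c|%N, `|numq c|%N; rewrite absz_gt0 denq_neq0; split=> //.
have d0 : (`|denq c|%N%:R : R) != 0 by rewrite pnatr_eq0 absz_eq0 denq_neq0.
apply: ln_inj; rewrite ?posrE ?exprn_gt0 // !lnXn // -mulr_natr -[RHS]mulr_natr.
move: Hc; rewrite /ratr numE -absz_denq -!pmulrn => /eqP.
by rewrite eqr_div ?(negbT (lt_eqF (ln0 i0))) // => /eqP ->; rewrite mulrC.
Qed.

End CommonBase.

(** * Integer solutions of the balance equations *)

Section IntegerSolutions.
Variable R : realType.

Lemma finite_lower_bound (I : finType) (u : I -> R) :
  (forall i, 0 < u i) -> exists2 e, 0 < e & forall i, e <= u i.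
Proof.
move=> u0; suff [e e0 He] : exists2 e, 0 < e & forall i, i \in enum I -> e <= u i.
  by exists e => // i; apply: He; rewrite mem_enum.
elim: (enum I) => [|i s [e e0 He]]; first by exists 1.
exists (Num.min (u i) e); first by rewrite lt_min u0.
by move=> i'; rewrite inE ge_min => /orP[/eqP ->|/He ->]; rewrite ?lexx ?orbT.
Qed.

(** A rational kernel has rational points near each of its real points, so a
    positive real solution of a rational system can be moved to a positive
    rational one, and then cleared of its denominators. *)
Lemma positive_integer_solution p n (A : 'M[rat]_(p, n)) (u : 'rV[R]_p) :
  (forall i, 0 < u ord0 i) -> u *m map_mx ratr A = 0 ->
  exists c : nat -> nat, (forall i : 'I_p, (0 < c i)%N) /\
    forall j, \sum_(i < p) (c i)%:R * A i j = 0.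
Proof.
move=> u0 uA; have [e e0 He] := finite_lower_bound u0.
have /submxP [D uD] : (u <= map_mx ratr (kermx A))%MS.
  by rewrite map_kermx; apply/sub_kermxP.
pose K := kermx A; pose B : R := 1 + \sum_i \sum_j `|ratr (K i j)|.
have B0 : 0 < B.
  by rewrite ltr_pwDl // sumr_ge0 // => i _; rewrite sumr_ge0.
have eB : 0 < e / B by rewrite divr_gt0.
have /choice [d Hd] i : exists d : rat,
    D ord0 i - e / B < ratr d < D ord0 i + e / B.
  have /rat_in_itvoo [d] : D ord0 i - e / B < D ord0 i + e / B by lra.
  by rewrite in_itv /=; exists d.
pose x : 'rV[rat]_p := (\row_i d i) *m K.
have xA : x *m A = 0 by rewrite -mulmxA mulmx_ker mulmx0.
have x0 i : 0 < x ord0 i.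
  rewrite -(ltr0q R) /x mxE rmorph_sum /=.
  have : `|u ord0 i - \sum_j ratr ((\row_i d i) ord0 j * K j i)| < u ord0 i.
    apply: lt_le_trans (He i).
    rewrite uD mxE -sumrB; apply: le_lt_trans (ler_norm_sum _ _ _) _.
    apply: (@le_lt_trans _ _ (\sum_j e / B * `|ratr (K j i)|)).
      apply: ler_sum => j _; rewrite !mxE rmorphM -mulrBl normrM ler_wpM2r //.
      by apply: ltW; rewrite distrC ltr_distl; exact: Hd.
    rewrite -mulr_sumr mulrAC ltr_pdivrMr // ltr_pM2l //.
    rewrite /B ltr_pwDl //; apply: ler_sum => j _.
    by rewrite (bigD1 i) //= lerDl sumr_ge0.
  by rewrite ltr_distl => /andP[]; lra.
pose M := \prod_i denq (x ord0 i).
have M0 : 0 < M by apply: prodr_gt0 => i _; exact: denq_gt0.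
have int_xM i : exists2 c : nat, (0 < c)%N & c%:R = x ord0 i * M%:~R.
  pose M' := \prod_(i' | i' != i) denq (x ord0 i').
  have ME : M = denq (x ord0 i) * M' by rewrite /M (bigD1 i).
  have zE : x ord0 i * M%:~R = (numq (x ord0 i) * M')%:~R.
    by rewrite ME !intrM mulrA -numqE.
  have z0 : 0 < numq (x ord0 i) * M'.
    by rewrite mulr_gt0 ?numq_gt0 // prodr_gt0 // => i' _; exact: denq_gt0.
  exists (absz (numq (x ord0 i) * M')); first by rewrite absz_gt0 gt_eqF.
  by rewrite zE pmulrn gez0_abs // ltW.
have /choice [c Hc] i : exists c : nat, (0 < c)%N /\ c%:R = x ord0 i * M%:~R.
  by have [c] := int_xM i; exists c.
exists (fun k => if insub k is Some i then c i else 0%N); split=> [i|j].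
  by rewrite valK; have [] := Hc i.
rewrite (eq_bigr (fun i => M%:~R * (x ord0 i * A i j))); last first.
  by move=> i _; rewrite valK; have [_ ->] := Hc i; rewrite mulrAC mulrC mulrA.
rewrite -mulr_sumr; have /matrixP /(_ ord0 j) := xA.
by rewrite mxE => ->; rewrite mxE mulr0.
Qed.

Lemma sum_shift (F : nzRingType) (f : nat -> F) M t k :
  (forall s, (M <= s)%N -> f s = 0) ->
  \sum_(s < M) f s * (t == s + k)%N%:R = if (k <= t)%N then f (t - k)%N else 0.
Proof.
move=> f0; have [kt|tk] := leqP k t; last first.
  rewrite big1 // => s _; case: eqP => [tE|]; last by rewrite mulr0.
  by move: tk; rewrite tE ltnNge leq_addl.
have E s : (t == s + k)%N = (s == t - k)%N.
  by apply/eqP/eqP => [->|->]; rewrite ?addnK ?subnK.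
have [lt|ge] := ltnP (t - k) M.
  rewrite (bigD1 (Ordinal lt)) //= E eqxx mulr1 big1 ?addr0 // => s.
  by rewrite -val_eqE /= E => /negPf ->; rewrite mulr0.
rewrite f0 // big1 // => s _; rewrite E; case: eqP => [sE|]; last by rewrite mulr0.
by move: ge; rewrite -sE leqNgt ltn_ord.
Qed.

End IntegerSolutions.

Section Balance.
Variables (R : realType) (T U : finType) (k : T -> nat) (l : U -> nat) (q : R).
Hypothesis q01 : 0 < q < 1.
Hypothesis k0 : forall i, (0 < k i)%N.
Hypothesis l0 : forall j, (0 < l j)%N.
Hypothesis k1 : \sum_i q ^+ k i = 1.
Hypothesis l1 : \sum_j q ^+ l j = 1.

(** The coefficients of (1 - Q) / (1 - z / q), where Q is the sum of the monomials
    with exponents [m], provided that Q(q) = 1. *)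
Let tail (V : finType) (m : V -> nat) (t : nat) : R :=
  \sum_j (if (t < m j)%N then q ^+ m j else 0) / q ^+ t.

Let tail_gt0 (V : finType) (m : V -> nat) t j :
  (t < m j)%N -> 0 < tail m t.
Proof.
have /andP[q0 _] := q01; move=> tj.
rewrite /tail (bigD1 j) //= tj ltr_pwDl ?divr_gt0 ?exprn_gt0 //.
by apply: sumr_ge0 => j' _; case: ifP; rewrite ?mul0r // divr_ge0 ?exprn_ge0 ?ltW.
Qed.

Let tail_eq0 (V : finType) (m : V -> nat) t :
  (forall j, (m j <= t)%N) -> tail m t = 0.
Proof. by move=> H; apply: big1 => j _; rewrite ltnNge H mul0r. Qed.

(** The terms with [t < m i] become pairs when multiplied by the sum, equal to 1, of
    the powers with exponents [n]; the result is symmetric in [m] and [n]. *)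
Let tail_balance (V W : finType) (m : V -> nat) (n : W -> nat) t :
  \sum_j q ^+ n j = 1 ->
  tail m t + \sum_i (if (m i <= t)%N then tail n (t - m i) else 0) =
  \sum_i \sum_j (if (t < m i + n j)%N then q ^+ (m i + n j) else 0) / q ^+ t.
Proof.
move=> n1; have /andP[q0 _] := q01; rewrite /tail -big_split /=.
apply: eq_bigr => i _; have [mt|tm] := leqP (m i) t; last first.
  rewrite addr0 -[LHS]mulr1 -n1 mulr_sumr; apply: eq_bigr => j _.
  by rewrite ltn_addr // exprD mulrAC.
rewrite mul0r add0r; apply: eq_bigr => j _; rewrite ltn_subLR //.
case: ifP => _; rewrite ?mul0r // -{2}(subnKC mt) !exprD.
by rewrite invfM mulrACA divff ?mul1r // lt0r_neq0 ?exprn_gt0.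
Qed.

(** For the polynomials a and b with these coefficients, and P, Q with exponents [k],
    [l], the balance is the coefficientwise form of a + Q b = b + P a. *)
Lemma integer_balance : exists M (a b : nat -> nat), [/\
  forall t, (M <= t)%N -> a t = 0%N, forall t, (M <= t)%N -> b t = 0%N,
  (0 < a 0)%N &
  forall t, (a t + \sum_j (if l j <= t then b (t - l j) else 0) =
             b t + \sum_i (if k i <= t then a (t - k i) else 0))%N].
Proof.
pose lm := (\max_j l j)%N; pose km := (\max_i k i)%N.
have tail_l t : (lm <= t)%N -> tail l t = 0.
  by move=> H; apply: tail_eq0 => j; apply: leq_trans H; exact: leq_bigmax.
have tail_k t : (km <= t)%N -> tail k t = 0.
  by move=> H; apply: tail_eq0 => j; apply: leq_trans H; exact: leq_bigmax.
have gt0_l t : (t < lm)%N -> 0 < tail l t.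
  rewrite /lm => H; have [j tj] : exists j, (t < l j)%N.
    apply: contrapT => Hn; move: H; rewrite ltnNge => /negP; apply.
    by apply/bigmax_leqP => j _; rewrite leqNgt; apply/negP => tj; apply: Hn; exists j.
  exact: tail_gt0 tj.
have gt0_k t : (t < km)%N -> 0 < tail k t.
  rewrite /km => H; have [j tj] : exists j, (t < k j)%N.
    apply: contrapT => Hn; move: H; rewrite ltnNge => /negP; apply.
    by apply/bigmax_leqP => j _; rewrite leqNgt; apply/negP => tj; apply: Hn; exists j.
  exact: tail_gt0 tj.
have [j0] := alphabet_inhabited l1.
have lm0 : (0 < lm)%N by apply: leq_trans (l0 j0) _; exact: leq_bigmax.
(* The first [lm] unknowns are the coefficients of a, the others those of b; the
   columns are the degrees. *)
pose A : 'M[rat]_(lm + km, lm + km) := \matrix_(s, t)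
  match fintype.split s with
  | inl s => ((t : nat) == s + 0)%N%:R - \sum_i ((t : nat) == s + k i)%N%:R
  | inr s => \sum_j ((t : nat) == s + l j)%N%:R - ((t : nat) == s + 0)%N%:R
  end.
have colA (F : nzRingType) (phi : {rmorphism rat -> F}) (c d : nat -> F) t :
    (forall s, (lm <= s)%N -> c s = 0) -> (forall s, (km <= s)%N -> d s = 0) ->
    \sum_(s < lm + km) (match fintype.split s with
      inl s => c s | inr s => d s end) * phi (A s t) =
    (c t - \sum_i (if (k i <= t)%N then c (t - k i)%N else 0)) +
    (\sum_j (if (l j <= t)%N then d (t - l j)%N else 0) - d t).
  move=> c0 d0; rewrite big_split_ord /=; congr (_ + _).
    under eq_bigr => s _.
      rewrite mxE (unsplitK (inl s)) rmorphB rmorph_sum /= rmorph_nat mulrBr mulr_sumr.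
      under [X in _ - X]eq_bigr do rewrite rmorph_nat.
      over.
    rewrite sumrB sum_shift // subn0 exchange_big /=; congr (_ - _).
    by apply: eq_bigr => i _; rewrite sum_shift.
  under eq_bigr => s _.
    rewrite mxE (unsplitK (inr s)) rmorphB rmorph_sum /= rmorph_nat mulrBr mulr_sumr.
    under [X in X - _]eq_bigr do rewrite rmorph_nat.
    over.
  rewrite sumrB [X in _ - X]sum_shift // subn0 exchange_big /=; congr (_ - _).
  by apply: eq_bigr => i _; rewrite sum_shift.
pose u : 'rV[R]_(lm + km) := \row_s
  match fintype.split s with inl s => tail l s | inr s => tail k s end.
have [||c [c0 Hc]] := @positive_integer_solution R _ _ A u.
- by move=> s; rewrite mxE; case: (fintype.split s) => s'; [apply: gt0_l|apply: gt0_k].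
- apply/rowP => t; rewrite !mxE.
  under eq_bigr do rewrite [u _ _]mxE [map_mx _ _ _ _]mxE.
  rewrite (colA _ (@ratr R) (tail l) (tail k)) //.
  have e1 := tail_balance l t k1; have e2 := tail_balance k t l1.
  have : tail l t + \sum_j (if (l j <= t)%N then tail k (t - l j) else 0) =
         tail k t + \sum_i (if (k i <= t)%N then tail l (t - k i) else 0).
    rewrite e1 e2 exchange_big /=; apply: eq_bigr => i _; apply: eq_bigr => j _.
    by rewrite (addnC (k i)).
  by move=> e; lra.
pose a t := if (t < lm)%N then c t else 0%N.
pose b t := if (t < km)%N then c (lm + t)%N else 0%N.
have a0 t : (lm <= t)%N -> a t = 0%N by rewrite /a ltnNge => ->.
have b0 t : (km <= t)%N -> b t = 0%N by rewrite /b ltnNge => ->.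
exists (lm + km)%N, a, b; split.
- by move=> t H; apply: a0; apply: leq_trans H; exact: leq_addr.
- by move=> t H; apply: b0; apply: leq_trans H; exact: leq_addl.
- by rewrite /a lm0; have := c0 (lshift km (Ordinal lm0)).
move=> t; have [tM|tM] := ltnP t (lm + km); last first.
  have atl : a t = 0%N by apply: a0; lia.
  have btk : b t = 0%N by apply: b0; lia.
  rewrite atl btk; congr (_ + _)%N; rewrite !big1 // => i _; case: ifP => // _.
    by apply: a0; have : (k i <= km)%N by [exact: leq_bigmax]; lia.
  by apply: b0; have : (l i <= lm)%N by [exact: leq_bigmax]; lia.
have e : \sum_(s < lm + km) (match fintype.split s with
    inl s => (a s)%:R | inr s => (b s)%:R end) * A s (Ordinal tM) = 0.
  rewrite -[RHS](Hc (Ordinal tM)); apply: eq_bigr => s _; congr (_ * _).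
  by case: (splitP s) => s' ->; rewrite /a /b ltn_ord.
move: e; rewrite (colA _ idfun (fun s => (a s)%:R) (fun s => (b s)%:R)) /=; first last.
- by move=> s /b0 ->.
- by move=> s /a0 ->.
move=> e; apply/eqP; rewrite -(eqr_nat rat) !natrD !natr_sum.
have nif (x : bool) (y : nat) : (if x then y%:R else 0) = (if x then y else 0%N)%:R :> rat.
  by case: x.
by under eq_bigr do rewrite -nif; under [in X in _ == X]eq_bigr do rewrite -nif; apply/eqP; lra.
Qed.

End Balance.

(** * Transducers *)

Section LevelSurjection.

(** Elements of the same rank within their levels are matched. *)
Lemma level_surjection (S D : finType) (f : S -> nat) (g : D -> nat) :
  (forall t, #|[pred s | f s == t]| = #|[pred d | g d == t]|) ->
  exists beta : S -> D, (forall s, g (beta s) = f s) /\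
    forall d, exists s, beta s = d.
Proof.
move=> H.
have /choice [beta Hbeta] s : exists d, g d = f s /\
    index d (enum [pred d | g d == f s]) = index s (enum [pred s' | f s' == f s]).
  have ss : s \in enum [pred s' | f s' == f s] by rewrite mem_enum inE.
  have sz : (index s (enum [pred s' | f s' == f s]) <
             size (enum [pred d | g d == f s]))%N.
    by rewrite -cardE -H cardE index_mem.
  case E : (enum [pred d | g d == f s]) sz => [//|d0 r]; rewrite -E => sz.
  exists (nth d0 (enum [pred d | g d == f s]) (index s (enum [pred s' | f s' == f s]))).
  rewrite index_uniq ?enum_uniq //; split=> //.
  by have := mem_nth d0 sz; rewrite mem_enum inE => /eqP.
exists beta; split=> [s|d]; first by have [] := Hbeta s.
have dd : d \in enum [pred d' | g d' == g d] by rewrite mem_enum inE.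
have sz : (index d (enum [pred d' | g d' == g d]) <
           size (enum [pred s | f s == g d]))%N.
  by rewrite -cardE H cardE index_mem.
case E : (enum [pred s | f s == g d]) sz => [//|s0 r]; rewrite -E => sz.
set s := nth s0 (enum [pred s | f s == g d]) (index d (enum [pred d' | g d' == g d])).
have fs : f s = g d by have := mem_nth s0 sz; rewrite mem_enum inE => /eqP.
exists s; have [gb ib] := Hbeta s; rewrite !fs in gb ib.
rewrite [RHS](_ : _ = nth d (enum [pred d' | g d' == g d])
    (index d (enum [pred d' | g d' == g d]))); last by rewrite nth_index.
rewrite -[in RHS](index_uniq s0 sz (enum_uniq _)) -/s -ib nth_index //.
by rewrite mem_enum inE gb.
Qed.

End LevelSurjection.

Section Transducer.
Variables (T U D : Type) (writes : D -> bool) (out : D -> T) (next : D -> D)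
  (read : D -> U -> D) (lev : D -> nat) (M : nat).
Hypothesis levM : forall d, (lev d < M)%N.
Hypothesis lev_read : forall d j, ~~ writes d -> (lev d < lev (read d j))%N.

(** The next writing state, with the remaining input.  Each reading raises the
    level, so that the fuel [M - lev d] suffices. *)
Let run : nat -> D -> (nat -> U) -> D * (nat -> U) :=
  fix run n d z := if writes d then (d, z) else
    if n is n'.+1 then run n' (read d (z 0%N)) (sskip 1 z) else (d, z).

Let run_stable n n' d z : (M - lev d <= n)%N -> (M - lev d <= n')%N ->
  run n d z = run n' d z.
Proof.
elim: n n' d z => [|n IHn] [|n'] d z; have lM := levM d; do ?lia.
move=> H H' /=; case: ifPn => // nw; have lt := lev_read (z 0%N) nw.
by apply: IHn; lia.
Qed.

(** Levels increase along consecutive readings, so a machine that either writes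
    a letter or reads one never stops writing. *)
Lemma transducer_exists : exists h : D -> (nat -> U) -> nat -> T,
  (forall d z, writes d -> h d z = scons (out d) (h (next d) z)) /\
  (forall d z, ~~ writes d -> h d z = h (read d (z 0%N)) (sskip 1 z)).
Proof.
pose h := fix h t d z {struct t} := let dz := run (M - lev d) d z in
  if t is t'.+1 then h t' (next dz.1) dz.2 else out dz.1.
have run_write d z n : writes d -> run n d z = (d, z) by case: n => [|n] /= ->.
exists (fun d z t => h t d z); split=> d z dw; apply/funext => -[|t] /=.
- by rewrite run_write.
- by rewrite run_write.
all: suff -> : run (M - lev d) d z =
    run (M - lev (read d (z 0%N))) (read d (z 0%N)) (sskip 1 z) by [].
all: have lt := lev_read (z 0%N) dw; have lM := levM d.
all: have -> : (M - lev d = (M - lev d).-1.+1)%N by lia.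
all: rewrite /= (negPf dw); apply: run_stable; lia.
Qed.

End Transducer.

Section LipschitzTransducer.
Variables (R : realType) (T U D : finType) (k : T -> nat) (l : U -> nat) (q : R).
Variables (w : T -> R) (v : U -> R).
Hypothesis q01 : 0 < q < 1.
Hypothesis k0 : forall i, (0 < k i)%N.
Hypothesis l0 : forall j, (0 < l j)%N.
Hypothesis wE : forall i, w i = q ^+ k i.
Hypothesis vE : forall j, v j = q ^+ l j.
Variables (d0 : D) (j0 : U) (writes : D -> bool) (out : D -> T) (next : D -> D)
  (read : D -> U -> D) (lev : D -> nat).
Hypothesis lev_write : forall d, writes d -> lev d = (k (out d) + lev (next d))%N.
Hypothesis lev_read : forall d j, ~~ writes d -> lev (read d j) = (lev d + l j)%N.
Hypothesis reached : forall d,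
  (forall i, exists d0, [/\ writes d0, out d0 = i & next d0 = d]) \/
  exists d0 j, ~~ writes d0 /\ read d0 j = d.

Let exp01 (V : finType) (m : V -> nat) (u : V -> R) :
  (forall i, 0 < m i)%N -> (forall i, u i = q ^+ m i) -> forall i, 0 < u i < 1.
Proof.
move=> m0 uE i; have /andP[q0 q1] := q01.
by rewrite uE exprn_gt0 //= exprn_ilt1 ?ltW // -lt0n.
Qed.

(** The level of a state records, in units of q, the scale at which it is
    run: this makes the weight of the letters read comparable with that of the
    letters written. *)
Lemma transducer_family : exists C (h : D -> (nat -> U) -> nat -> T),
  [/\ 1 <= C, forall d, lip v w C (h d) & forall x, exists d z, h d z = x].
Proof.
have /andP[q0 q1] := q01.
have w01 := exp01 k0 wE; have v01 := exp01 l0 vE.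
pose M := (\max_d lev d).+1.
have levM d : (lev d < M)%N by rewrite ltnS leq_bigmax.
have [d j nw|h [hw hr]] := @transducer_exists T U D writes out next read lev M levM.
  by rewrite lev_read // -[ltnLHS]addn0 ltn_add2l.
pose C d := q ^+ lev d / q ^+ M.
have C1 d : 1 <= C d.
  by rewrite ler_pdivlMr ?exprn_gt0 // mul1r ler_wiXn2l ?(ltW q0) ?(ltW q1) // ltnW.
(* Both inputs are read in step until the letter [b] is written.  If they already
   differ when a letter is to be read, then [a] is 0 and nothing is claimed,
   since the constants are at least 1. *)
have lipC d : lip v w (C d) (h d).
  move=> z z' a b; elim: b d z z' a => [|b IHb] d z z' a.
    have [n] := ubnP (M - lev d); elim: n d z z' a => // n IHn d z z' a.
    rewrite ltnS => Hn ag; have [dw|nw] := boolP (writes d).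
      by move=> _; rewrite (hw d z) // (hw d z') // => -[|t].
    rewrite prefix_wt0; case: a ag => [|a] ag.
      by rewrite prefix_wt0 mulr1 ltNge C1.
    move: ag => /agreeS [z0 ag]; rewrite (hr d z) // (hr d z') // -z0 => lt.
    have lr := lev_read (z 0%N) nw; have lM := levM d; have lz := l0 (z 0%N).
    apply: (IHn _ _ _ a) ag _; first by lia.
    rewrite prefix_wt0; apply: le_lt_trans lt.
    by rewrite /C lr prefix_wtS vE exprD mulrACA mulrA.
  have [n] := ubnP (M - lev d); elim: n d z z' a => // n IHn d z z' a.
  rewrite ltnS => Hn ag; have [dw|nw] := boolP (writes d).
    rewrite (hw d z) // (hw d z') // => lt; apply: agree_scons; apply: IHb ag _.
    move: lt; rewrite prefix_wtS /= wE sskip1_scons /C lev_write // exprD.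
    by rewrite -!mulrA ltr_pM2l ?exprn_gt0.
  case: a ag => [|a] ag.
    by rewrite prefix_wt0 mulr1 ltNge (le_trans (prefix_wt_le1 w01 _ _)).
  move: ag => /agreeS [z0 ag]; rewrite (hr d z) // (hr d z') // -z0 => lt.
  have lr := lev_read (z 0%N) nw; have lM := levM d; have lz := l0 (z 0%N).
  apply: (IHn _ _ _ a) ag _; first by lia.
  apply: le_lt_trans lt.
  by rewrite /C lr prefix_wtS vE exprD mulrACA mulrA.
have Cmax d : C d <= q ^- M.
  by rewrite /C ger_pMl ?invr_gt0 ?exprn_gt0 // exprn_ile1 // ltW.
(* Any letter can be written just before any given state is entered, after going
   back through finitely many readings. *)
have dense K x : exists d z, agree K (h d z) x.
  elim: K x => [|K IHK] x.
    by exists d0, (fun=> j0).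
  have [d [z ag]] := IHK (sskip 1 x).
  suff back : forall d z i, exists d0 z0, h d0 z0 = scons i (h d z).
    have [d1 [z1 e]] := back d z (x 0%N); exists d1, z1; rewrite e.
    by rewrite -[x in agree _ _ x]scons_drop; apply: agree_scons.
  move=> {}d {ag}{}z i; have [n] := ubnP (lev d).
  elim: n d z => // n IHn d z; rewrite ltnS => Hn.
  have [/(_ i) [d' [dw <- <-]]|[d' [j [nw e]]]] := reached d.
    by exists d', z; rewrite hw.
  have [|d1 [z1 e1]] := IHn d' (scons j z).
    by move: Hn; rewrite -e lev_read //; have := l0 j; lia.
  by exists d1, z1; rewrite e1 hr //= e.
exists (q ^- M), h; split.
- by rewrite invf_ge1 ?exprn_gt0 // exprn_ile1 // ltW.
- by move=> d; apply: lip_weaken (lipC d).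
move=> x; have [F [FU Foo]] := ultra_oo.
have /choice [dz Hdz] K : exists dz, agree K (h dz.1 dz.2) x.
  by have [d [z]] := dense K x; exists (d, z).
have [d Fd] := ultra_limit_fin (fun K => (dz K).1) FU.
have [z Fz] := ultra_limit_seq (fun K => (dz K).2) FU.
exists d, z; apply: agree_all => b.
have [a Ha] := prefix_wt_small v01
  (divr_gt0 (prefix_wt_gt0 w01 x b) (lt_le_trans ltr01 (C1 d))).
have : F ([set K | (dz K).1 = d] `&` [set K | agree a (dz K).2 z] `&` [set K | (b <= K)%N]).
  by apply: filterI; [apply: filterI|].
move=> /filter_ex [K [[H1 H2] H3]].
have Hx := agree_le H3 (Hdz K); rewrite H1 in Hx.
apply: (agree_trans _ Hx); apply: agree_sym; apply: agree_le (leqnSn b) _.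
apply: (lipC d) H2 _; rewrite (agree_prefix_wt w Hx) mulrC -ltr_pdivlMr //.
exact: lt_le_trans ltr01 (C1 d).
Qed.

End LipschitzTransducer.

(** * Surjections between systems with a common base *)

Section Merge.
Variables (R : realType) (T U : finType) (w : T -> R) (v : U -> R).
Hypothesis w01 : forall i, 0 < w i < 1.
Hypothesis v01 : forall j, 0 < v j < 1.
Hypothesis v1 : \sum_j v j = 1.

Lemma two_letters : exists j0 j1 : U, j0 != j1.
Proof.
have [j0] := alphabet_inhabited v1; apply: contrapT => H.
have /andP[_] := v01 j0; rewrite -v1 (bigD1 j0) //= big1 ?addr0 ?ltxx //.
by move=> j jj0; case: H; exists j, j0.
Qed.

(** The first letter of the input selects the map to be applied to the rest. *)
Lemma merge_two C f1 f2 : 1 <= C -> lip v w C f1 -> lip v w C f2 ->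
  exists C' f, [/\ 1 <= C', lip v w C' f, forall z, exists z', f z' = f1 z &
    forall z, exists z', f z' = f2 z].
Proof.
move=> C1 L1 L2; have [j0 [j1 j01]] := two_letters.
have [lo [hi [lo0 lo1 _ _ vlo]]] := weight_bounds v01.
pose f z := if z 0%N == j0 then f1 (sskip 1 z) else f2 (sskip 1 z).
have C0 : 0 < C := lt_le_trans ltr01 C1.
exists (C / lo), f; split.
- by rewrite ler_pdivlMr // mul1r (le_trans _ C1) // ltW.
- move=> z z' [|a] b.
    move=> _; rewrite prefix_wt0 mulr1 ltNge => /negP []; apply: (@le_trans _ _ 1).
      exact: prefix_wt_le1.
    by rewrite ler_pdivlMr // mul1r (le_trans _ C1) // ltW.
  move=> /agreeS [z0 ag] lt; have {}lt : C * prefix_wt v (sskip 1 z) a < prefix_wt w (f z) b.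
    apply: le_lt_trans lt; rewrite prefix_wtS mulrA ler_pM2r ?prefix_wt_gt0 //.
    rewrite -mulrA ler_peMr ?(ltW C0) // mulrC ler_pdivlMr // mul1r.
    by have /andP[] := vlo (z 0%N).
  move: lt; rewrite /f -z0; case: ifP => _; [exact: L1|exact: L2].
- by move=> z; exists (scons j0 z); rewrite /f /= eqxx.
- by move=> z; exists (scons j1 z); rewrite /f /= eq_sym (negPf j01).
Qed.

Lemma merge_family (D : finType) C (h : D -> (nat -> U) -> nat -> T) :
  1 <= C -> (forall d, lip v w C (h d)) -> (forall x, exists d z, h d z = x) ->
  inhabited T ->
  exists C' f, [/\ 1 <= C', lip v w C' f & forall x, exists z, f z = x].
Proof.
move=> C1 hC hsurj [t0].
suff [C' [f [C'1 fC' H]]] : exists C' f, [/\ 1 <= C', lip v w C' f &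
    forall d z, d \in enum D -> exists z', f z' = h d z].
  exists C', f; split=> // x; have [d [z <-]] := hsurj x.
  by apply: H; rewrite mem_enum.
elim: (enum D) => [|d s [C' [f [C'1 fC' H]]]].
  by exists 1, (fun=> fun=> t0); split.
have m1 : C <= Num.max C C' by rewrite le_max lexx.
have m2 : C' <= Num.max C C' by rewrite le_max lexx orbT.
have [C2 [f2 [C21 L2 H1 H2]]] := merge_two (le_trans C1 m1)
  (lip_weaken v01 m1 (hC d)) (lip_weaken v01 m2 fC').
exists C2, f2; split=> // d' z; rewrite inE => /orP[/eqP -> //|/(H _ z) [z' <-]].
exact: H2.
Qed.

End Merge.

Section CommonBaseSurjection.
Variables (R : realType) (T U : finType) (k : T -> nat) (l : U -> nat) (q : R).
Variables (w : T -> R) (v : U -> R).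
Hypothesis q01 : 0 < q < 1.
Hypothesis k0 : forall i, (0 < k i)%N.
Hypothesis l0 : forall j, (0 < l j)%N.
Hypothesis wE : forall i, w i = q ^+ k i.
Hypothesis vE : forall j, v j = q ^+ l j.
Hypothesis pw : probability_vector w.
Hypothesis pv : probability_vector v.

Let count_shift (M : nat) (a : nat -> nat) (t s : nat) :
  (forall t, (M <= t)%N -> a t = 0%N) ->
  (\sum_(x : {u : 'I_M & 'I_(a u)}) (s + tag x == t) =
   if s <= t then a (t - s) else 0)%N.
Proof.
move=> a0; rewrite -(sig_big_dep xpredT (fun u : 'I_M => xpredT)
  (fun (u : 'I_M) (c : 'I_(a u)) => nat_of_bool (s + u == t)%N)) /=.
apply/eqP; rewrite -(eqr_nat rat) natr_sum.
under eq_bigr => u _ do rewrite sum_nat_const card_ord natrM addnC eq_sym.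
rewrite (sum_shift (f := fun u => (a u)%:R)) => [|u /a0 -> //].
by case: ifP.
Qed.

(** A [Slot] is a cylinder of the multiset a, and a [Cut] a subdivision prescribed
    by b.  The cylinders at hand are the slots and the parts produced by the cuts;
    each of them either is subdivided by a cut or becomes a slot of the copy
    attached to a letter.  The balance equations allow [beta] to make this
    assignment within each level, that is without changing sizes. *)
Theorem common_base_surjection : exists C f,
  [/\ 0 < C, lip v w C f & forall x, exists z, f z = x].
Proof.
have [[w01 w1] [v01 v1]] := (pw, pv).
have k1 : \sum_i q ^+ k i = 1.
  by rewrite -w1; apply: eq_bigr => i _; rewrite wE.
have l1 : \sum_j q ^+ l j = 1.
  by rewrite -v1; apply: eq_bigr => j _; rewrite vE.
have [M [a [b [a0 b0 a00 bal]]]] := integer_balance q01 l0 k1 l1.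
have [t0] := alphabet_inhabited w1; have [j0] := alphabet_inhabited v1.
pose Slot := {u : 'I_M & 'I_(a u)}; pose Cut := {u : 'I_M & 'I_(b u)}.
pose src_lev (s : Slot + Cut * U) : nat :=
  match s with inl x => tag x | inr p => (l p.2 + tag p.1)%N end.
pose dst_lev (d : Cut + T * Slot) : nat :=
  match d with inl e => tag e | inr p => (k p.1 + tag p.2)%N end.
have [t|beta [betaL betaS]] := @level_surjection _ _ src_lev dst_lev.
  have card_sum (V : finType) (P : pred V) : #|[pred x | P x]| = (\sum_x P x)%N.
    by rewrite -sum1_card big_mkcond; apply: eq_bigr => x _; rewrite inE; case: P.
  rewrite !card_sum !big_sumType /=.
  have := count_shift t 0 a0; have := count_shift t 0 b0.
  rewrite !subn0 /= => -> ->.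
  rewrite (_ : (\sum_i _)%N = (\sum_j if l j <= t then b (t - l j) else 0)%N).
    rewrite bal; congr (_ + _)%N; apply/esym.
    rewrite -(pair_bigA _ (fun i (x : Slot) => nat_of_bool (k i + tag x == t)%N)) /=.
    by apply: eq_bigr => i _; exact: count_shift.
  rewrite -(pair_bigA _ (fun (x : Cut) j => nat_of_bool (l j + tag x == t)%N)) /= exchange_big.
  by apply: eq_bigr => j _; exact: count_shift.
(* [next] is meaningful on writing states and [read] on reading states only. *)
pose writes (d : Cut + T * Slot) := if d is inr _ then true else false.
pose out (d : Cut + T * Slot) := if d is inr (i, _) then i else t0.
pose next (d : Cut + T * Slot) := if d is inr (_, x) then beta (inl x) else d.
pose read (d : Cut + T * Slot) j := if d is inl e then beta (inr (e, j)) else d.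
have M0 : (0 < M)%N.
  by rewrite lt0n; apply/eqP => M0; move: a00; rewrite a0 ?M0.
pose d0 : Cut + T * Slot :=
  inr (t0, Tagged (fun u : 'I_M => 'I_(a u)) (i := Ordinal M0) (Ordinal a00)).
have [|||C [h [C1 hC hS]]] := @transducer_family R T U _ k l q w v q01 k0 l0 wE vE
    d0 j0 writes out next read dst_lev.
- by move=> [//|[i x]] _ /=; rewrite betaL.
- by move=> [e j _|//] /=; rewrite betaL /= addnC.
- move=> d; have [[x|[e j]] <-] := betaS d; [left|right].
    by move=> i; exists (inr (i, x)).
  by exists (inl e), j.
have [C' [f [C'1 fC' fS]]] := merge_family w01 v01 v1 C1 hC hS (inhabits t0).
by exists C', f; split=> //; apply: lt_le_trans C'1.
Qed.

End CommonBaseSurjection.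

(** * Coding of dust-like self-similar sets *)

Section EuclideanDistance.
Variables (R : realType) (d : nat).
Implicit Types (x y z : 'rV[R]_d).

Lemma edist_nonneg x y : 0 <= edist x y.
Proof. exact: sqrtr_ge0. Qed.

Lemma edistxx x : edist x x = 0.
Proof. by rewrite /edist big1 ?sqrtr0 // => i _; rewrite subrr expr0n. Qed.

Lemma edist_symm x y : edist x y = edist y x.
Proof. by congr Num.sqrt; apply: eq_bigr => i _; rewrite -sqrrN opprB. Qed.

Lemma edist_coord x y i : `|x ord0 i - y ord0 i| <= edist x y.
Proof.
rewrite -sqrtr_sqr ler_wsqrtr // (bigD1 i) //= lerDl sumr_ge0 // => j _.
exact: sqr_ge0.
Qed.

Lemma edist_le x y e : (forall i, `|x ord0 i - y ord0 i| <= e) -> 0 <= e ->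
  edist x y <= d.+1%:R * e.
Proof.
move=> H e0; have de0 : 0 <= d.+1%:R * e by rewrite mulr_ge0.
rewrite -[leRHS](ger0_norm de0) -sqrtr_sqr ler_wsqrtr //.
apply: (@le_trans _ _ (\sum_(i < d) e ^+ 2)).
  by apply: ler_sum => i _; rewrite -[leLHS]real_normK ?num_real // ler_sqr // nnegrE.
rewrite sumr_const card_ord exprMn -[leLHS]mulr_natl ler_wpM2r ?sqr_ge0 //.
by rewrite -natrX ler_nat -mulnn; lia.
Qed.

Lemma edist0_eq x y : edist x y <= 0 -> x = y.
Proof.
move=> H; apply/rowP => i; apply/eqP; rewrite -subr_eq0 -normr_le0.
exact: le_trans (edist_coord x y i) H.
Qed.

(** The comparison with the sup norm gives the triangle inequality up to a
    constant, which is all that compactness arguments need. *)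
Lemma edist_quasi_triangle x y z :
  edist x z <= d.+1%:R * (edist x y + edist y z).
Proof.
apply: edist_le => [i|]; last by rewrite addr_ge0 ?edist_nonneg.
apply: le_trans (lerD (edist_coord x y i) (edist_coord y z i)).
exact: ler_distD.
Qed.

Lemma ultra_limit_edist (X : set 'rV[R]_d) (p : nat -> 'rV[R]_d) F :
  UltraFilter F -> compact X -> (forall k, X (p k)) ->
  exists2 q, X q & forall e, 0 < e -> F [set k | edist q (p k) < e].
Proof.
move=> FU cX Xp; have [q Xq Hq] := ultra_limit_compact FU cX Xp.
exists q => // e e0; have d0 : 0 < (d.+2%:R : R) by rewrite ltr0n.
have ed0 : 0 < e / d.+2%:R by rewrite divr_gt0.
have FF : Filter F by exact: _.
apply: filterS (Hq _ (nbhsx_ballx q _ ed0)) => k /= Bk.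
apply: (@le_lt_trans _ _ (d.+1%:R * (e / d.+2%:R))).
  apply: edist_le => [i|]; last exact: ltW.
  by have := Bk.2 ord0 i; rewrite -ball_normE => /ltW.
by rewrite mulrCA gtr_pMr // ltr_pdivrMr // mul1r ltr_nat.
Qed.

Lemma edist_small_eq x y : (forall e, 0 < e -> edist x y <= e) -> x = y.
Proof.
by move=> H; apply: edist0_eq; apply/ler_addgt0Pr => e e0; rewrite add0r H.
Qed.

Lemma compact_bounded_edist (X : set 'rV[R]_d) : compact X ->
  exists2 C, 0 < C & forall p p', X p -> X p' -> edist p p' <= C.
Proof.
move=> cX; apply: contrapT => Hn; have [F [FU Foo]] := ultra_oo.
have /choice [pp Hpp] k : exists pp : 'rV[R]_d * 'rV[R]_d,
    [/\ X pp.1, X pp.2 & k.+1%:R < edist pp.1 pp.2].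
  apply: contrapT => Hk; apply: Hn; exists k.+1%:R; first by rewrite ltr0n.
  move=> p p' Xp Xp'; rewrite leNgt; apply/negP => lt.
  by apply: Hk; exists (p, p').
have X1 k : X (pp k).1 by have [] := Hpp k.
have X2 k : X (pp k).2 by have [] := Hpp k.
have [q Xq Hq] := ultra_limit_edist FU cX X1.
have [q' Xq' Hq'] := ultra_limit_edist FU cX X2.
have FF : Filter F by exact: _.
pose K : R := d.+1%:R; pose B := K * (1 + K * (edist q q' + 1)).
have : F ([set k | edist q (pp k).1 < 1] `&` [set k | edist q' (pp k).2 < 1]
    `&` [set k | (Num.bound B <= k)%N]).
  by apply: filterI; [apply: filterI; [exact: Hq|exact: Hq']|exact: Foo].
move=> /filter_ex [k [[H1 H2] H3]]; have [_ _] := Hpp k; rewrite ltNge => /negP; apply.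
have K0 : 0 <= K by rewrite ler0n.
have B0 : 0 <= B by rewrite mulr_ge0 // addr_ge0 // mulr_ge0 // addr_ge0 // edist_nonneg.
apply: (@le_trans _ _ B); last first.
  by apply: ltW; apply: lt_le_trans (archi_boundP B0) _; rewrite ler_nat leqW.
apply: le_trans (edist_quasi_triangle _ q _) _; rewrite ler_wpM2l //.
rewrite edist_symm lerD ?(ltW H1) //.
apply: le_trans (edist_quasi_triangle _ q' _) _; rewrite ler_wpM2l //.
by rewrite lerD2l ltW.
Qed.

End EuclideanDistance.

(** A bi-Lipschitz parametrization by sequences, for the ultrametric in which the
    weight of a prefix is the product of the ratios of its letters. *)
Record coding (R : realType) (d : nat) (T : finType) (r : T -> R)
    (X : set 'rV[R]_d) := Coding {
  code :> (nat -> T) -> 'rV[R]_d;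
  code_hi : R;
  code_lo : R;
  code_hi_gt0 : 0 < code_hi;
  code_lo_gt0 : 0 < code_lo;
  code_in : forall x, X (code x);
  code_onto : forall p, X p -> exists x, code x = p;
  code_close : forall x x' a, agree a x x' ->
    edist (code x) (code x') <= code_hi * prefix_wt r x a;
  code_far : forall x x' a,
    edist (code x) (code x') < code_lo * prefix_wt r x a -> agree a.+1 x x' }.

Lemma code_inj (R : realType) (d : nat) (T : finType) (r : T -> R)
    (X : set 'rV[R]_d) (pi : coding r X) : (forall i, 0 < r i < 1) -> injective pi.
Proof.
move=> r01 x x' e; apply: agree_all => a; apply: agree_le (leqnSn a) _.
by apply: (@code_far _ _ _ _ _ pi); rewrite e edistxx mulr_gt0 ?prefix_wt_gt0 ?code_lo_gt0.
Qed.

Section Coding.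
Variables (R : realType) (d n : nat) (Phi : ifs R d n) (X : set 'rV[R]_d).
Hypothesis hX : self_similar Phi X.
Hypothesis dX : dust_like Phi X.
Hypothesis X0 : X !=set0.
Let r := ifs_ratio Phi.

Let r01 i : 0 < r i < 1. Proof. exact: ifs_ratio_itv. Qed.

Let X_map i p : X p -> X (Phi i p).
Proof. by have [_ XE] := hX; move=> Xp; rewrite XE; exists i => //; exists p. Qed.

Let X_inv p : X p -> exists i p', X p' /\ Phi i p' = p.
Proof. by have [_ XE] := hX; rewrite {1}XE => -[i _ [p' Xp' <-]]; exists i, p'. Qed.

Let word_map (I : seq 'I_n) (p : 'rV[R]_d) := foldr (fun i => Phi i) p I.

Let word_map_X I p : X p -> X (word_map I p).
Proof. by move=> Xp; elim: I => //= i I; apply: X_map. Qed.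

Let word_map_edist I p p' : edist (word_map I p) (word_map I p') = wt r I * edist p p'.
Proof.
elim: I => [|i I IHI] /=; first by rewrite wt_nil mul1r.
by rewrite ifs_similarity IHI wt_cons mulrA.
Qed.

Let word_map_cat I J p : word_map (I ++ J) p = word_map I (word_map J p).
Proof. by rewrite /word_map foldr_cat. Qed.

(** A limit of the images of a base point under the prefixes of [x].  The tails of
    [x] provide limits in the same way, of which it is the image. *)
Let coded_point (x : nat -> 'I_n) : exists p, forall a,
  exists2 p', X p' & p = word_map (mkseq x a) p'.
Proof.
have [F [FU Foo]] := ultra_oo; have [p0 Xp0] := X0; have [cX _] := hX.
pose p a k := word_map (mkseq (sskip a x) k) p0.
have Xp a k : X (p a k) by apply: word_map_X.
have lim a := ultra_limit_edist FU cX (fun k => Xp a (k - a)%N).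
have [q Xq Hq] := lim 0%N; exists q => a; have [q' Xq' Hq'] := lim a; exists q' => //.
apply: edist_small_eq => e e0.
have D0 : 0 < (d.+1%:R : R) by rewrite ltr0n.
have e20 : 0 < e / d.+1%:R / 2 by rewrite !divr_gt0.
have FF : Filter F by exact: _.
have : F ([set k | edist q (p 0%N (k - 0)%N) < e / d.+1%:R / 2]
    `&` [set k | edist q' (p a (k - a)%N) < e / d.+1%:R / 2] `&` [set k | (a <= k)%N]).
  by apply: filterI; [apply: filterI; [exact: Hq|exact: Hq']|exact: Foo].
move=> /filter_ex [k [[H1 H2] H3]]; rewrite /= subn0 in H1.
apply: le_trans (edist_quasi_triangle _ (p 0%N k) _) _.
rewrite -ler_pdivlMl // [X in _ <= X]mulrC [leRHS]splitr lerD ?(ltW H1) //.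
have -> : p 0%N k = word_map (mkseq x a) (p a (k - a)%N).
  rewrite /p sskip0 -word_map_cat; congr word_map.
  by rewrite -mkseq_addn subnKC.
rewrite word_map_edist edist_symm; apply: le_trans (ltW H2).
by rewrite ler_piMl ?edist_nonneg // wt_le1.
Qed.

(** Two pieces at distance 0 would have a common point, by compactness. *)
Let gap : exists2 c, 0 < c & forall i j p p', i != j -> X p -> X p' ->
  c <= edist (Phi i p) (Phi j p').
Proof.
apply: contrapT => Hn; have [F [FU Foo]] := ultra_oo; have [cX _] := hX.
have /choice [z Hz] k : exists z : ('I_n * 'I_n) * ('rV[R]_d * 'rV[R]_d),
    [/\ z.1.1 != z.1.2, X z.2.1, X z.2.2 &
      edist (Phi z.1.1 z.2.1) (Phi z.1.2 z.2.2) < k.+1%:R^-1].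
  apply: contrapT => Hk; apply: Hn; exists k.+1%:R^-1; first by rewrite invr_gt0 ltr0n.
  move=> i j p p' ij Xp Xp'; rewrite leNgt; apply/negP => lt.
  by apply: Hk; exists ((i, j), (p, p')).
have [ij Fij] := ultra_limit_fin (fun k => (z k).1) FU.
have X1 k : X (z k).2.1 by have [] := Hz k.
have X2 k : X (z k).2.2 by have [] := Hz k.
have [q Xq Hq] := ultra_limit_edist FU cX X1.
have [q' Xq' Hq'] := ultra_limit_edist FU cX X2.
have FF : Filter F by exact: _.
have ne : ij.1 != ij.2.
  by have /filter_ex [k <-] := Fij; have [] := Hz k.
suff e : Phi ij.1 q = Phi ij.2 q'.
  have : (Phi ij.1 @` X `&` Phi ij.2 @` X) (Phi ij.1 q).
    by split; [exists q | rewrite e; exists q'].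
  by rewrite dX.
apply: edist_small_eq => e e0; pose K : R := d.+1%:R.
have K0 : 0 < K by rewrite ltr0n.
pose e' := e / (K * (1 + K * 2)).
have D0 : 0 < K * (1 + K * 2) by rewrite mulr_gt0 // addr_gt0 // mulr_gt0.
have e'0 : 0 < e' by rewrite divr_gt0.
have : F ([set k | (z k).1 = ij] `&` [set k | edist q (z k).2.1 < e']
   `&` [set k | edist q' (z k).2.2 < e'] `&` [set k | (Num.bound e'^-1 <= k)%N]).
  apply: filterI; [apply: filterI; [apply: filterI; [exact: Fij|exact: Hq]|
    exact: Hq']|exact: Foo].
move=> /filter_ex [k [[[H1 H2] H3] H4]]; have [_ _ _ lt] := Hz k.
rewrite H1 in lt.
have {}lt : edist (Phi ij.1 (z k).2.1) (Phi ij.2 (z k).2.2) <= e'.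
  apply: le_trans (ltW lt) _; rewrite -[leRHS]invrK lef_pV2 ?posrE ?invr_gt0 ?ltr0n //.
  have /archi_boundP /ltW /le_trans : 0 <= e'^-1 by rewrite invr_ge0 ltW.
  by apply; rewrite ler_nat (leq_trans H4).
have contr i p p' : edist (Phi i p) (Phi i p') <= edist p p'.
  have /andP[ri0 ri1] := r01 i.
  by rewrite ifs_similarity ler_piMl ?edist_nonneg // ltW.
rewrite -(divfK (lt0r_neq0 D0) e) -/e' mulrC -mulrA.
apply: le_trans (edist_quasi_triangle _ (Phi ij.1 (z k).2.1) _) _.
rewrite ler_pM2l // mulrDl mul1r lerD //; first exact: le_trans (contr _ _ _) (ltW H2).
apply: le_trans (edist_quasi_triangle _ (Phi ij.2 (z k).2.2) _) _.
rewrite -mulrA ler_pM2l // mulr_natl mulr2n lerD // edist_symm.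
exact: le_trans (contr _ _ _) (ltW H3).
Qed.

Theorem coding_exists : inhabited (coding r X).
Proof.
have [pi Hpi] := choice coded_point; have [cX _] := hX.
have [C C0 HC] := compact_bounded_edist cX; have [c c0 Hc] := gap.
have close x a p p' : X p -> X p' ->
    edist (word_map (mkseq x a) p) (word_map (mkseq x a) p') <= C * prefix_wt r x a.
  by move=> Xp Xp'; rewrite word_map_edist mulrC ler_pM2r ?HC ?wt_gt0.
apply: inhabits; apply: (@Coding _ _ _ r X pi C c) => //.
- by move=> x; have [p' Xp' ->] := Hpi x 0%N.
- move=> p Xp.
  have /choice [nxt Hnxt] q : exists ip : 'I_n * 'rV[R]_d,
      X q -> X ip.2 /\ Phi ip.1 ip.2 = q.
    have [Xq|nXq] := pselect (X q).
      by have [i [p' ?]] := X_inv Xq; exists (i, p').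
    by have [i _] := X_inv Xp; exists (i, p).
  pose orb t := iter t (fun q => (nxt q).2) p; pose x t := (nxt (orb t)).1.
  have Xorb t : X (orb t).
    by elim: t => [//|t IHt]; rewrite /orb iterS; have [] := Hnxt _ IHt.
  have pE a : p = word_map (mkseq x a) (orb a).
    elim: a => [//|a IHa]; rewrite {1}IHa mkseqS -cats1 word_map_cat /=.
    by have [_ ->] := Hnxt _ (Xorb a).
  exists x; apply: edist_small_eq => e e0.
  have [a Ha] := prefix_wt_small r01 (divr_gt0 e0 C0).
  have [p' Xp' ->] := Hpi x a; rewrite [X in edist _ X](pE a).
  apply: le_trans (close _ _ _ _ Xp' (Xorb a)) _.
  by rewrite mulrC -ler_pdivlMr // ltW.
- move=> x x' a ag; have [p Xp ->] := Hpi x a; have [p' Xp' ->] := Hpi x' a.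
  by rewrite -(agree_mkseq ag); exact: close.
move=> x x' a lt; apply: contrapT => Hag.
have xx' : x <> x' by move=> e; apply: Hag; rewrite e.
have [b [agb nagb]] := first_difference xx'.
have ba : (b <= a)%N.
  by rewrite leqNgt; apply/negP => ab; apply: Hag; apply: agree_le agb.
have ne : x b != x' b.
  apply/eqP => e; apply: nagb => t; rewrite ltnS leq_eqVlt => /orP[/eqP ->//|].
  exact: agb.
move: lt; rewrite ltNge => /negP; apply.
apply: (@le_trans _ _ (c * prefix_wt r x b)).
  by rewrite ler_pM2l // prefix_wt_le.
have [p Xp ->] := Hpi x b.+1; have [p' Xp' ->] := Hpi x' b.+1.
rewrite !mkseqS -!cats1 !word_map_cat -(agree_mkseq agb) word_map_edist mulrC.
by rewrite ler_pM2l ?wt_gt0 // Hc.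
Qed.

End Coding.

(** * The dimension of a dust-like self-similar set *)

Section Moran.
Variables (R : realType) (T : finType) (r : T -> R).
Hypothesis r01 : forall i, 0 < r i < 1.

Let r0 i : 0 < r i. Proof. by have /andP[] := r01 i. Qed.

(** The sum decreases continuously from the number of letters at 0 to 0 at infinity. *)
Lemma moran_exponent : (exists i j : T, i != j) ->
  exists2 s, 0 < s & \sum_i r i `^ s = 1.
Proof.
move=> [i0 [i1 i01]]; pose f s := \sum_i r i `^ s.
have f0 : 1 < f 0.
  rewrite /f (bigD1 i0) //= (bigD1 i1) /=; last by rewrite eq_sym.
  rewrite !powRr0 ltrDl ltr_pwDl // sumr_ge0 // => i _; exact: powR_ge0.
have [lo [hi [_ _ hi0 hi1 Hr]]] := weight_bounds r01.
have N0 : 0 < (#|T|.+1%:R : R) by rewrite ltr0n.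
have [a Ha] : exists a, hi ^+ a < (#|T|.+1%:R)^-1.
  by apply: expr_small; rewrite ?hi0 // invr_gt0.
have fa : f a%:R < 1.
  apply: (@le_lt_trans _ _ (\sum_(i : T) (#|T|.+1%:R)^-1)).
    apply: ler_sum => i _; rewrite powR_mulrn; last exact: ltW.
    apply: ltW; apply: le_lt_trans Ha; apply: lerXn2r; rewrite ?nnegrE ?(ltW hi0) ?(ltW (r0 i)) //.
    by have /andP[] := Hr i.
  rewrite sumr_const -[X in X < _]mulr_natl ltr_pdivrMr // mul1r ltr_nat.
  by rewrite ltnS cardE.
have cf : continuous f.
  apply: continuous_big => [|i _ s]; first exact: add_continuous.
  have -> : powR (r i) = expR \o (fun s => s * ln (r i)).
    by apply/funext => t; rewrite /powR gt_eqF.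
  apply: continuous_comp; last exact: continuous_expR.
  by apply: cvgMl; exact: cvg_id.
have [||s] := @IVT R f 0 a%:R 1 (ler0n _ a).
- exact: continuous_subspaceT.
- by rewrite ge_min le_max (ltW fa) (ltW f0) orbT.
rewrite in_itv /= => /andP[s0 _] fs; exists s => //; rewrite lt_neqAle s0 andbT.
by apply/eqP => e; move: f0; rewrite e fs ltxx.
Qed.

Lemma powR_prefix s x a :
  prefix_wt (fun i => r i `^ s) x a = prefix_wt r x a `^ s.
Proof.
elim: a x => [|a IHa] x; first by rewrite !prefix_wt0 powR1.
by rewrite !prefix_wtS IHa powRM // ltW ?prefix_wt_gt0.
Qed.

Lemma powR_wt s I : wt (fun i => r i `^ s) I = wt r I `^ s.
Proof.
elim: I => [|i I IHI]; first by rewrite !wt_nil powR1.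
by rewrite !wt_cons IHI powRM // ltW ?wt_gt0.
Qed.

Lemma powR01 s i : 0 < s -> 0 < r i `^ s < 1.
Proof.
move=> s0; rewrite powR_gt0 //=; have /andP[/ltW ri0 ri1] := r01 i.
by have := gt0_ltr_powR s0 ri0 ler01 ri1; rewrite powR1.
Qed.

End Moran.

Section Diameter.
Variables (R : realType) (d : nat).
Implicit Type U : set 'rV[R]_d.

Lemma diam_le U (B : R) : (forall p p', U p -> U p' -> edist p p' <= B) ->
  (diam U <= B%:E)%E.
Proof. by move=> H; apply: ge_ereal_sup => _ [p Up [p' Up' <-]]; rewrite lee_fin H. Qed.

Lemma edist_le_diam U p p' : U p -> U p' -> ((edist p p')%:E <= diam U)%E.
Proof. by move=> Up Up'; apply: ereal_sup_ubound; exists p => //; exists p'. Qed.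

Lemma diam_ge0 U : U !=set0 -> (0 <= diam U)%E.
Proof. by move=> [p Up]; have := edist_le_diam Up Up; rewrite edistxx. Qed.

Lemma diam_pow_ge0 s U : (0 <= diam_pow s U)%E.
Proof. by rewrite /diam_pow; case: ifP => // _; exact: poweR_ge0. Qed.

Lemma diam_pow_le s U (B : R) : 0 < s -> 0 <= B -> (diam U <= B%:E)%E ->
  (diam_pow s U <= (B `^ s)%:E)%E.
Proof.
move=> s0 B0 H; rewrite /diam_pow; case: eqP => [_|/eqP/set0P U0].
  by rewrite lee_fin powR_ge0.
rewrite -poweR_EFin; apply: gt0_ler_poweR => //; first exact: ltW.
  by rewrite in_itv /= diam_ge0 // leey.
by rewrite in_itv /= lee_fin B0 leey.
Qed.

Lemma hausdorff_content_ge0 s delta (A : set 'rV[R]_d) :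
  (0 <= hausdorff_content s delta A)%E.
Proof.
apply: le_ereal_inf_tmp => _ [U _ <-].
by apply: nneseries_ge0 => k _ _; exact: diam_pow_ge0.
Qed.

Lemma hausdorff_measure_eq0 s (A : set 'rV[R]_d) :
  (forall delta e, 0 < delta -> 0 < e -> exists U : (set 'rV[R]_d)^nat,
    [/\ A `<=` \bigcup_k U k, forall k, (diam (U k) <= delta%:E)%E &
     (\sum_(k <oo) diam_pow s (U k) <= e%:E)%E]) ->
  hausdorff_measure s A = 0%E.
Proof.
move=> H; apply/eqP; rewrite eq_le; apply/andP; split.
  apply: ge_ereal_sup => _ [delta /= d0 <-].
  apply/lee_addgt0Pr => e e0; rewrite add0e.
  have [U [AU Ud Ue]] := H _ _ d0 e0.
  by apply: ge_ereal_inf; exists (\sum_(k <oo) diam_pow s (U k))%E => //; exists U.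
apply: le_ereal_sup_tmp; exists (hausdorff_content s 1 A).
  by exists 1 => //=.
exact: hausdorff_content_ge0.
Qed.

Lemma hausdorff_dim_le (A : set 'rV[R]_d) s : 0 <= s ->
  (forall s', s < s' -> hausdorff_measure s' A = 0%E) ->
  (hausdorff_dim A <= s%:E)%E.
Proof.
move=> s0 H; apply/lee_addgt0Pr => e e0; apply: ge_ereal_inf.
exists (s + e)%:E => //; exists (s + e) => //=.
by split; [rewrite addr_ge0 // ltW | apply: H; rewrite ltrDl].
Qed.

Lemma hausdorff_dim_point (p : 'rV[R]_d) : (hausdorff_dim [set p] <= 0)%E.
Proof.
apply: (hausdorff_dim_le (s := 0)) => // s s0; apply: hausdorff_measure_eq0.
have dp : (diam [set p] <= 0%:E)%E.
  by apply: diam_le => _ _ -> ->; rewrite edistxx.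
move=> delta e delta0 e0; exists (fun=> [set p]); split.
- by move=> q ->; exists 0%N.
- by move=> _; apply: le_trans dp _; rewrite lee_fin ltW.
rewrite eseries0; first by rewrite lee_fin ltW.
move=> k _ _; apply/eqP; rewrite eq_le diam_pow_ge0 andbT.
by have := diam_pow_le s0 (lexx 0) dp; rewrite powR0 // gt_eqF.
Qed.

End Diameter.

Section LightCovers.
Variables (R : realType) (T : finType) (w : T -> R).
Hypothesis w01 : forall i, 0 < w i < 1.
Hypothesis w1 : \sum_i w i = 1.

(** A sequence escaping all the cylinders is built letter by letter: the total
    weight of the words extending the current prefix stays below the weight of
    this prefix. *)
Lemma light_cylinders_miss (W : nat -> seq T) :
  (\sum_(k <oo) (wt w (W k))%:E < 1)%E ->
  exists x : nat -> T, forall k, mkseq x (size (W k)) <> W k.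
Proof.
pose load J := (\sum_(k <oo) (if prefix J (W k) then wt w (W k) else 0)%:E)%E.
have term0 J k : (0 <= (if prefix J (W k) then wt w (W k) else 0)%:E)%E.
  by rewrite lee_fin; case: ifP => // _; rewrite ltW // wt_gt0.
have pcat J i s : prefix (rcons J i) (J ++ s) = if s is i' :: _ then i == i' else false.
  elim: J => [|j J IHJ]; last by rewrite /= eqxx.
  by case: s => //= i' s; rewrite prefix0s andbT.
have [t0] := alphabet_inhabited w1 => H.
have /choice [nxt Hnxt] J : exists i, (load J < (wt w J)%:E)%E ->
    (load (rcons J i) < (wt w (rcons J i))%:E)%E.
  apply: contrapT => Hn; have Hi i : (load J < (wt w J)%:E)%E /\
      ((wt w (rcons J i))%:E <= load (rcons J i))%E.
    split; apply: contrapT => Hc; apply: Hn; exists i => // lt.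
    by rewrite ltNge; apply/negP => Hle; apply: Hc.
  have [+ _] := Hi t0; rewrite ltNge => /negP; apply.
  have -> : (wt w J)%:E = (\sum_i (wt w (rcons J i))%:E)%E.
    rewrite sumEFin; congr _%:E; rewrite -[LHS]mulr1 -w1 mulr_sumr.
    by apply: eq_bigr => i _; rewrite -cats1 wt_cat wt_cons wt_nil mulr1.
  apply: (@le_trans _ _ (\sum_i load (rcons J i))%E).
    by apply: lee_sum => i _; have [] := Hi i.
  rewrite /load -nneseries_sum //; apply: lee_nneseries.
    by move=> k _ _; apply: sume_ge0 => i _; exact: term0.
  move=> k _; rewrite sumEFin lee_fin -big_mkcond /=.
  case: ifPn => [/prefixP [[|i' s] ->]|nJ].
  - rewrite big_pred0 => [|i]; first by rewrite ltW // wt_gt0.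
    by rewrite pcat.
  - rewrite (big_pred1 i') // => i; exact: pcat.
  rewrite big_pred0 // => i; apply/negP => Hp; move: nJ => /negP; apply.
  exact: prefix_trans (prefix_rcons _ _) Hp.
pose J a := iter a (fun J => rcons J (nxt J)) [::].
have HJ a : (load (J a) < (wt w (J a))%:E)%E.
  elim: a => [|a IHa]; last by rewrite /J iterS; exact: Hnxt.
  by rewrite wt_nil /load; under eq_eseriesr do rewrite prefix0s.
pose x t := nxt (J t).
have xJ a : mkseq x a = J a.
  by elim: a => [//|a IHa]; rewrite mkseqS IHa /J iterS.
exists x => k; rewrite xJ => e; have := HJ (size (W k)); rewrite e ltNge => /negP; apply.
apply: le_trans (nneseries_lim_ge k.+1 _); last by move=> *; exact: term0.
rewrite big_nat_recr //= prefix_refl leeDr // sume_ge0 // => i _; exact: term0.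
Qed.

End LightCovers.

Section CodedDimension.
Variables (R : realType) (d : nat) (T : finType) (r : T -> R).
Variables (X : set 'rV[R]_d) (pi : coding r X) (s : R).
Hypothesis r01 : forall i, 0 < r i < 1.
Hypothesis s0 : 0 < s.
Hypothesis s1 : \sum_i r i `^ s = 1.

Let C := code_hi pi.
Let c := code_lo pi.
Let C0 : 0 < C := code_hi_gt0 pi.
Let c0 : 0 < c := code_lo_gt0 pi.
Let Xpi := code_in pi.
Let pi_surj := @code_onto _ _ _ _ _ pi.
Let pi_close := @code_close _ _ _ _ _ pi.
Let pi_far := @code_far _ _ _ _ _ pi.
Let w i := r i `^ s.

Let w01 i : 0 < w i < 1. Proof. exact: powR01. Qed.

Let wt_root I : wt r I = wt w I `^ s^-1.
Proof.
by rewrite powR_wt // -powRrM divff ?gt_eqF // powRr1 // ltW // wt_gt0.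
Qed.

(** Cutting at a small threshold gives covers by cylinders whose sum of s-th powers
    of the diameters is bounded, so that the sum of powers with a larger exponent
    is small. *)
Let coded_dim_le : (hausdorff_dim X <= s%:E)%E.
Proof.
apply: (hausdorff_dim_le (ltW s0)) => s' ss'; apply: hausdorff_measure_eq0.
move=> delta e delta0 e0; pose K := C `^ s'.
have K0 : 0 < K by rewrite powR_gt0.
have s'0 : 0 < s' := lt_trans s0 ss'.
have sB : 0 < s' - s by rewrite subr_gt0.
pose th := Num.min ((delta / C) `^ s) ((e / K) `^ (s / (s' - s))).
have th0 : 0 < th by rewrite lt_min !powR_gt0 ?divr_gt0.
have w0 i : 0 <= w i by rewrite powR_ge0.
have [S [S1 HS cov]] := cut_exists w01 s1 w0 ltr01 th0.
have small I : I \in S -> wt r I <= delta / C /\ wt r I `^ (s' - s) <= e / K.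
  move=> IS; have [+ _] := HS I IS; rewrite mul1r le_min => /andP[H1 H2].
  have wI := wt_gt0 w01 I; have si : 0 <= s^-1 by rewrite invr_ge0 ltW.
  split.
    have -> : delta / C = ((delta / C) `^ s) `^ s^-1.
      by rewrite -powRrM divff ?gt_eqF // powRr1 // ltW // divr_gt0.
    by rewrite wt_root; apply: ge0_ler_powR; rewrite ?nnegrE ?powR_ge0 // ltW.
  have -> : e / K = ((e / K) `^ (s / (s' - s))) `^ ((s' - s) / s).
    rewrite -powRrM mulrA divfK ?gt_eqF // divff ?gt_eqF // powRr1 // ltW //.
    exact: divr_gt0.
  rewrite wt_root -powRrM [s^-1 * _]mulrC.
  by apply: ge0_ler_powR; rewrite ?nnegrE ?powR_ge0 // ?divr_ge0 ?ltW.
pose cyl I := pi @` [set x | exists x', x = scat I x'].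
pose U k := if (k < size S)%N then cyl (nth [::] S k) else set0.
have diam_cyl I : (diam (cyl I) <= (C * wt r I)%:E)%E.
  apply: diam_le => _ _ [_ [x ->] <-] [_ [x' ->] <-].
  have ag : agree (size I) (scat I x) (scat I x').
    by have := @agree_scat _ I 0 x x' (@agree0 _ _ _); rewrite addn0.
  have := pi_close ag; have := prefix_wt_scat r I x 0.
  by rewrite addn0 prefix_wt0 mulr1 => ->.
have wtr0 I : 0 < wt r I := wt_gt0 r01 I.
pose g k := if (k < size S)%N then wt w (nth [::] S k) else 0.
have g0 k : 0 <= g k by rewrite /g; case: ifP => // _; rewrite ltW // wt_gt0.
have g1 : (\sum_(k <oo) (g k)%:E <= 1)%E.
  rewrite (nneseries_split 0 (size S)) => [|k _]; last by rewrite lee_fin.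
  rewrite add0n [X in (_ + X)%E]eseries0 ?adde0; last first.
    by move=> k Sk _; rewrite /g ltnNge Sk.
  rewrite sumEFin lee_fin -S1 [leRHS](big_nth [::]) [leLHS]big_nat [leRHS]big_nat.
  by apply: ler_sum => k /andP[_ kS]; rewrite /g kS.
exists U; split.
- move=> p Xp; have [x <-] := pi_surj Xp; have [I IS [x' xE]] := cov x.
  exists (index I S) => //; rewrite /U index_mem IS nth_index //.
  by exists x => //; exists x'.
- move=> k; rewrite /U; case: ifP => [kS|_]; last first.
    by apply: diam_le.
  apply: le_trans (diam_cyl _) _; rewrite lee_fin mulrC -ler_pdivlMr //.
  by have [] := small _ (mem_nth [::] kS).
have e0' : (0 <= e%:E)%E by rewrite lee_fin ltW.
have -> : e%:E = (e%:E * 1)%E by rewrite mule1.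
apply: (@le_trans _ _ (e%:E * \sum_(k <oo) (g k)%:E)%E); last exact: lee_wpmul2l.
rewrite -nneseriesZl; last first.
  by move=> k _; rewrite lee_fin.
apply: lee_nneseries => [k _ _|k _]; first exact: diam_pow_ge0.
rewrite -EFinM /U /g; case: ifP => [kS|_]; last by rewrite /diam_pow eqxx mulr0.
set I := nth [::] S k; have IS : I \in S by apply: mem_nth.
apply: (le_trans (diam_pow_le s'0 _ (diam_cyl I))).
  by rewrite mulr_ge0 ?(ltW C0) ?(ltW (wtr0 I)).
rewrite lee_fin powRM ?(ltW C0) ?(ltW (wtr0 I)) // -/K.
have -> : wt r I `^ s' = wt r I `^ (s' - s) * wt w I.
  by rewrite powR_wt // -powRD ?subrK // gt_eqF // implybT.
have [_] := small _ IS; rewrite ler_pdivlMr // => H.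
rewrite mulrA ler_wpM2r ?(ltW (wt_gt0 w01 I)) //.
by rewrite mulrC.
Qed.

(** A set of diameter D meets [X] inside one cylinder of size comparable with D, as
    distinct cylinders are far apart; sets of diameter 0 are put into cylinders of
    negligible weight.  Hence a cover with a small sum would give cylinders
    covering all sequences with total weight less than 1. *)
Let coded_dim_ge : (s%:E <= hausdorff_dim X)%E.
Proof.
apply: le_ereal_inf_tmp => _ [s' [s'0 H] <-]; rewrite lee_fin leNgt; apply/negP => s's.
pose K := c `^ (- s); have K0 : 0 < K by rewrite powR_gt0.
have : (hausdorff_content s' 1 X <= 0)%E.
  by rewrite -H; apply: ereal_sup_ubound; exists 1 => //=.
pose e := (4 * K)^-1; have e0 : 0 < e by rewrite invr_gt0 mulr_gt0.
have e0' : (0 < e%:E)%E by rewrite lte_fin.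
move=> /le_lt_trans /(_ e0') /ereal_inf_lt [_ [U [XU Ud] <-] Ue].
have key k : exists W : seq T, (forall x, (U k) (pi x) -> mkseq x (size W) = W) /\
    ((wt w W)%:E <= K%:E * diam_pow s' (U k) + (2^-1 / (2 ^ k.+1)%:R)%:E)%E.
  pose b : R := 2^-1 / (2 ^ k.+1)%:R; have b0 : 0 < b.
    by rewrite divr_gt0 // ltr0n expn_gt0.
  have Kd : (0 <= K%:E * diam_pow s' (U k))%E.
    by rewrite mule_ge0 ?diam_pow_ge0 // lee_fin ltW.
  have tiny x : exists a, prefix_wt w x a <= b.
    by have [a Ha] := prefix_wt_small w01 b0; exists a; rewrite ltW.
  have tiny_ok (x : nat -> T) a : prefix_wt w x a <= b ->
      ((wt w (mkseq x a))%:E <= K%:E * diam_pow s' (U k) + b%:E)%E.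
    by move=> H'; rewrite -[leLHS]add0e leeD // lee_fin.
  have [[x Ux]|nU] := pselect (exists x, U k (pi x)); last first.
    have [t0] := alphabet_inhabited s1; have [a Ha] := tiny (fun=> t0).
    exists (mkseq (fun=> t0) a); split; last exact: tiny_ok.
    by move=> x Ux; case: nU; exists x.
  have U0 : U k !=set0 by exists (pi x).
  have := Ud k; have := diam_ge0 U0; move: (erefl (diam (U k))).
  case: {-2}(diam (U k)) => [D DE||] //; rewrite !lee_fin => D0 D1.
  have close x' : U k (pi x') -> edist (pi x) (pi x') <= D.
    by move=> Ux'; rewrite -lee_fin DE; exact: edist_le_diam.
  move: D0; rewrite le_eqVlt => /orP[/eqP D0|D0].
    have [a Ha] := tiny x; exists (mkseq x a); split; last exact: tiny_ok.
    move=> x' Ux'; rewrite size_mkseq; apply/esym/agree_mkseq.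
    apply: agree_le (leqnSn a) _; apply: pi_far.
    by apply: le_lt_trans (close _ Ux') _; rewrite -D0 mulr_gt0 // prefix_wt_gt0.
  have ex : exists a, c * prefix_wt r x a <= D.
    have [a Ha] := prefix_wt_small r01 (divr_gt0 D0 c0); exists a.
    by rewrite mulrC -ler_pdivlMr // ltW.
  case: (ex_minnP ex) => a Ha mina; exists (mkseq x a); split.
    move=> x' Ux'; rewrite size_mkseq; apply/esym/agree_mkseq.
    case: a Ha mina => [//|a] Ha mina; apply: pi_far.
    apply: le_lt_trans (close _ Ux') _; rewrite ltNge; apply/negP => /mina.
    by rewrite ltnn.
  rewrite -[leLHS]adde0 leeD // ?lee_fin ?(ltW b0) //.
  rewrite /diam_pow; case: eqP U0 => [->|_ _]; first by case.
  rewrite -DE poweR_EFin -EFinM lee_fin.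
  have -> : wt w (mkseq x a) = prefix_wt r x a `^ s by exact: powR_prefix.
  have le : prefix_wt r x a <= D / c by rewrite ler_pdivlMr // mulrC.
  apply: (@le_trans _ _ ((D / c) `^ s)).
    apply: ge0_ler_powR => //; rewrite ?nnegrE ?(ltW s0) ?(ltW (divr_gt0 D0 c0)) //.
    exact: ltW (prefix_wt_gt0 r01 _ _).
  rewrite powRM ?invr_ge0 ?(ltW D0) ?(ltW c0) // -powR_inv1 ?(ltW c0) //.
  rewrite -powRrM mulN1r mulrC ler_pM2l //.
  apply: ger_powR; [by rewrite D0 D1 | exact: ltW].
have /choice [W HW] := key.
have [|x Hx] := @light_cylinders_miss R T w w01 s1 W.
  apply: (@le_lt_trans _ _
     (\sum_(k <oo) (K%:E * diam_pow s' (U k) + (2^-1 / (2 ^ k.+1)%:R)%:E))%E).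
    apply: lee_nneseries => [k _ _|k _]; last by have [] := HW k.
    by rewrite lee_fin ltW // wt_gt0.
  apply: le_lt_trans (epsilon_trick _ _ _) _ => [k||].
  - by rewrite mule_ge0 ?diam_pow_ge0 // lee_fin ltW.
  - by rewrite invr_ge0.
  rewrite nneseriesZl => [|k _]; last exact: diam_pow_ge0.
  have lt : (K%:E * \sum_(k <oo) diam_pow s' (U k) <= (4^-1)%:E)%E.
    have -> : 4^-1 = K * e by rewrite /e invfM mulrCA divff ?mulr1 ?gt_eqF.
    by rewrite EFinM lee_wpmul2l ?lee_fin ?ltW.
  apply: le_lt_trans (leeD lt (lexx _)) _.
  by rewrite -EFinD lte_fin; lra.
have [k _ Uk] := XU _ (Xpi x); have [Wk _] := HW k.
exact: Hx (Wk _ Uk).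
Qed.

Theorem coded_dimension : hausdorff_dim X = s%:E.
Proof. by apply/eqP; rewrite eq_le coded_dim_le coded_dim_ge. Qed.

End CodedDimension.

(** * Transfer between sets and sequences *)

Section Transfer.
Variables (R : realType) (d e : nat) (T U : finType) (r : T -> R) (rho : U -> R).
Variables (X : set 'rV[R]_d) (Y : set 'rV[R]_e).
Variables (piX : coding r X) (piY : coding rho Y) (s : R).
Hypothesis r01 : forall i, 0 < r i < 1.
Hypothesis rho01 : forall j, 0 < rho j < 1.
Hypothesis s0 : 0 < s.

Let w i := r i `^ s.
Let v j := rho j `^ s.

Lemma powR_lt_inv a b : 0 <= a -> 0 <= b -> a `^ s < b `^ s -> a < b.
Proof.
move=> a0 b0; rewrite !ltNge => H; apply/negP => ba; move: H => /negP; apply.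
by apply: ge0_ler_powR; rewrite ?nnegrE ?(ltW s0).
Qed.

Lemma address_exists : Y !=set0 ->
  exists addr : 'rV[R]_e -> nat -> U, forall q, Y q -> piY (addr q) = q.
Proof.
move=> [q0 Yq0]; have [y0 _] := code_onto piY Yq0.
have /choice [addr Haddr] q : exists y, Y q -> piY y = q.
  have [Yq|nYq] := pselect (Y q); last by exists y0.
  by have [y <-] := code_onto piY Yq; exists y.
by exists addr.
Qed.

(** Distances are comparable with weights of prefixes, and raising to the power [s]
    turns the ratios into the weights and a constant [K] into [K `^ s]. *)
Lemma symbolic_of_lipschitz f : Y !=set0 -> lipschitz_surjection X Y f ->
  exists L F, [/\ 0 < L, lip w v L F & forall y, exists x, F x = y].
Proof.
move=> Y0 [fXY [L0 HL0]]; have [addr Haddr] := address_exists Y0.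
pose L := Num.max L0 1; have L1 : 0 < L by rewrite lt_max ltr01 orbT.
have HL p p' : X p -> X p' -> edist (f p) (f p') <= L * edist p p'.
  move=> Xp Xp'; apply: le_trans (HL0 _ _ Xp Xp') _.
  by apply: ler_wpM2r; rewrite ?edist_nonneg // /L le_max lexx.
have hi0 := code_hi_gt0 piX; have lo0 := code_lo_gt0 piY.
pose K := L * code_hi piX / code_lo piY.
have K0 : 0 < K by rewrite divr_gt0 // mulr_gt0.
have Yf x : Y (f (piX x)) by rewrite -fXY; exists (piX x) => //; exact: code_in.
exists (K `^ s), (fun x => addr (f (piX x))); split; first exact: powR_gt0.
- move=> x x' a b ag; rewrite !powR_prefix // -powRM ?(ltW K0) ?(ltW (prefix_wt_gt0 r01 _ _)) //.
  have Kr : 0 <= K * prefix_wt r x a by rewrite mulr_ge0 // ltW // prefix_wt_gt0.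
  move=> /(powR_lt_inv Kr (ltW (prefix_wt_gt0 rho01 _ _))) lt; apply: (@code_far _ _ _ _ _ piY).
  rewrite !Haddr //; apply: le_lt_trans (HL _ _ _ _) _; try exact: code_in.
  apply: (@le_lt_trans _ _ (L * (code_hi piX * prefix_wt r x a))).
    by rewrite ler_pM2l // code_close.
  by move: lt; rewrite /K mulrAC ltr_pdivrMr // mulrA [X in _ < X]mulrC.
- move=> y; have : Y (piY y) by exact: code_in.
  rewrite -{1}fXY => -[p Xp fp]; have [x xp] := code_onto piX Xp; exists x.
  by rewrite xp fp; apply: (code_inj (pi := piY) rho01); rewrite Haddr //; exact: code_in.
Qed.

Lemma lipschitz_of_symbolic L F : Y !=set0 -> 0 < L -> lip v w L F ->
  (forall x, exists y, F y = x) ->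
  exists g : 'rV[R]_e -> 'rV[R]_d, lipschitz_surjection Y X g.
Proof.
move=> Y0 L0 HF Fsurj; have [addr Haddr] := address_exists Y0.
have hi0 := code_hi_gt0 piX; have lo0 := code_lo_gt0 piY.
pose M := L `^ s^-1; have M0 : 0 < M by rewrite powR_gt0.
have LM : L = M `^ s by rewrite -powRrM mulVf ?gt_eqF // powRr1 // ltW.
exists (fun q => piX (F (addr q))); split.
  apply/seteqP; split=> [_ [q Yq <-]|p Xp]; first exact: code_in.
  have [x <-] := code_onto piX Xp; have [y <-] := Fsurj x.
  have Yy : Y (piY y) by exact: code_in.
  exists (piY y) => //; congr (piX (F _)).
  by apply: (code_inj (pi := piY) rho01); rewrite Haddr.
exists (code_hi piX * M / code_lo piY) => q q' Yq Yq'.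
have K0 : 0 <= code_hi piX * M / code_lo piY.
  by rewrite ltW // divr_gt0 // mulr_gt0.
have [e0|ne] := pselect (F (addr q) = F (addr q')).
  by rewrite e0 edistxx mulr_ge0 // edist_nonneg.
have ne' : addr q <> addr q' by move=> e0; apply: ne; rewrite e0.
have [a [aga naga]] := first_difference ne'.
have [b [agb nagb]] := first_difference ne.
have far : code_lo piY * prefix_wt rho (addr q) a <= edist q q'.
  rewrite leNgt; apply/negP => lt; apply: naga.
  by apply: (@code_far _ _ _ _ _ piY); rewrite !Haddr.
have near : prefix_wt r (F (addr q)) b <= M * prefix_wt rho (addr q) a.
  rewrite leNgt; apply/negP => lt; apply: nagb; apply: HF aga _.
  have Mr : 0 <= M * prefix_wt rho (addr q) a.
    by rewrite mulr_ge0 ?(ltW M0) ?(ltW (prefix_wt_gt0 rho01 _ _)).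
  rewrite LM !powR_prefix // -powRM ?(ltW M0) ?(ltW (prefix_wt_gt0 rho01 _ _)) //.
  by apply: gt0_ltr_powR; rewrite ?nnegrE // ltW // prefix_wt_gt0.
apply: le_trans (code_close piX agb) _.
rewrite -!mulrA ler_pM2l //; apply: (le_trans near).
by rewrite ler_pM2l // ler_pdivlMl.
Qed.

End Transfer.

Lemma no_two_letters (R : realType) (d n : nat) (Phi : ifs R d n) (X : set 'rV[R]_d) :
  self_similar Phi X -> dust_like Phi X -> ~ (exists i j : 'I_n, i != j) ->
  forall p p', X p -> X p' -> p = p'.
Proof.
move=> hX dX one p p' Xp Xp'.
have [pi] := coding_exists hX dX (ex_intro _ p Xp).
have [x <-] := code_onto pi Xp; have [x' <-] := code_onto pi Xp'.
congr (pi _); apply/funext => t; apply: contrapT => /eqP ne.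
by apply: one; exists (x t), (x' t).
Qed.

Theorem corollary1p5 (R : realType) (d e n m : nat)
    (Phi : ifs R d n) (Psi : ifs R e m)
    (X : set 'rV[R]_d) (Y : set 'rV[R]_e)
    (hX : self_similar Phi X) (hY : self_similar Psi Y)
    (dX : dust_like Phi X) (dY : dust_like Psi Y)
    (hcomm : commensurable (ratios Phi) \/ commensurable (ratios Psi))
    (hdim : hausdorff_dim X = hausdorff_dim Y)
    (hXY : exists f : 'rV[R]_d -> 'rV[R]_e, lipschitz_surjection X Y f) :
  exists g : 'rV[R]_e -> 'rV[R]_d, lipschitz_surjection Y X g.
Proof.
have [f [fXY fL]] := hXY.
have [X0|X0] := pselect (X !=set0); last first.
  have XE : X = set0 by apply: contrapT => /eqP/set0P.
  have YE : Y = set0 by rewrite -fXY XE image_set0.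
  by exists (fun=> 0); rewrite XE YE; split; [rewrite image_set0 | exists 0].
have Y0 : Y !=set0.
  by have [p Xp] := X0; exists (f p); rewrite -fXY; exists p.
have r01 := ifs_ratio_itv Phi; have rho01 := ifs_ratio_itv Psi.
have [two|one] := pselect (exists i j : 'I_n, i != j); last first.
  have [p Xp] := X0; exists (fun=> p); split; last first.
    by exists 0 => q q' _ _; rewrite edistxx mul0r.
  apply/seteqP; split=> [_ [q _ <-] //|p' Xp']; have [q Yq] := Y0.
  by exists q => //; exact: (no_two_letters hX dX one).
have [s s0 s1] := moran_exponent r01 two.
have [piX] := coding_exists hX dX X0; have [piY] := coding_exists hY dY Y0.
have dimX := coded_dimension piX r01 s0 s1.
have [two'|one'] := pselect (exists i j : 'I_m, i != j); last first.
  (* A point has dimension 0, but [s] is positive. *)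
  have [q Yq] := Y0; have YE : Y = [set q].
    apply/seteqP; split=> [q' Yq'|_ ->//]; exact: (no_two_letters hY dY one').
  have := hausdorff_dim_point q; rewrite -YE -hdim dimX.
  by rewrite lee_fin leNgt s0.
have [s' s'0 s'1] := moran_exponent rho01 two'.
have ss' : s' = s.
  have := coded_dimension piY rho01 s'0 s'1.
  by rewrite -hdim dimX => -[].
subst s'.
have pw : probability_vector (fun i => ifs_ratio Phi i `^ s).
  by split=> // i; exact: powR01.
have pv : probability_vector (fun j => ifs_ratio Psi j `^ s).
  by split=> // i; exact: powR01.
have pow (I : finType) (z : I -> R) : (forall i, 0 < z i < 1) ->
    commensurable (range z) ->
    exists2 p, 0 < p < 1 & powers_of p (fun i => z i `^ s).
  move=> z01 /(commensurable_powers z01) [q q01 zq].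
  exists (q `^ s); first exact: (powR01 (r := fun _ : unit => q) (fun=> q01) tt).
  move=> i; have [k kE] := zq i; exists k; have /andP[/ltW q0 _] := q01.
  by rewrite kE -(powR_mulrn k q0) -(powR_mulrn k (powR_ge0 q s)) powRAC.
have [L [F [L0 FL Fsurj]]] := symbolic_of_lipschitz piX piY r01 rho01 s0 Y0 (conj fXY fL).
have [q [q01 wq vq]] : exists q, [/\ 0 < q < 1,
    powers_of q (fun i => ifs_ratio Phi i `^ s) &
    powers_of q (fun j => ifs_ratio Psi j `^ s)].
  by case: hcomm => H; have [p p01 Hp] := pow _ _ (ifs_ratio_itv _) H;
    apply: (common_base pw pv L0 FL Fsurj p01); [left|right].
have [k kE] := choice wq; have [l lE] := choice vq.
have pos (I : finType) (z : I -> R) (k' : I -> nat) : probability_vector z ->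
    (forall i, z i = q ^+ k' i) -> forall i, (0 < k' i)%N.
  move=> [z01 _] zE i; have /andP[_] := z01 i; rewrite zE lt0n.
  by apply: contraTneq => ->; rewrite expr0 ltxx.
have [C [G [C0 GC Gsurj]]] := common_base_surjection q01 (pos _ _ _ pw kE)
  (pos _ _ _ pv lE) kE lE pw pv.
exact: (lipschitz_of_symbolic piX piY r01 rho01 s0 Y0 C0 GC Gsurj).
Qed.
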